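(* (i) For each positive integer $n$, $T_n\subseteq\{\,tt't\mid t\in T_0 \text{ and } t'\in T_m \text{ for some } m\le n-1\,\}$. (ii) Suppose that $W$ is an infinite Coxeter group with $\#S<\infty$. Then $0<\#T_n\le (\#T_0)^{n+1}-(\#T_0)^n$ for each positive integer $n$.
   Context: Coxeter datum. Let $V$ be a real vector space with a symmetric bilinear form $(\,,\,)$. For $A\subseteq V$, $\mathrm{PLC}(A)$ is the set of all (finite) sums $\sum_{a\in A}\lambda_a a$ with all $\lambda_a\ge 0$ and some $\lambda_{a'}>0$. A subset $\Delta\subseteq V$ is a root basis if (C1) $(a,a)=1$ for all $a\in\Delta$, and for distinct $a,b\in\Delta$ either $(a,b)=-\cos(\pi/m_{ab})$ for an integer $m_{ab}=m_{ba}\ge 2$, or $(a,b)\le -1$ (then $m_{ab}=m_{ba}=\infty$); (C2) $0\notin\mathrm{PLC}(\Delta)$. ($\Delta$ may be infinite or linearly dependent.) Fix such a Coxeter datum $(V,\Delta,(\,,\,))$. Let $(W,S)$, $S=\{r_a\mid a\in\Delta\}$, be the Coxeter system in which the $r_a$ are involutions and $r_ar_b$ has order $m_{ab}$; $W$ acts on $V$ (faithfully, preserving the form) by $r_a x=x-2(x,a)a$. Let $\ell$ be its length function, $\Phi=\{wa\mid w\in W,a\in\Delta\}$, $\Phi^+=\Phi\cap\mathrm{PLC}(\Delta)$ (positive roots), $\Phi^-=-\Phi^+$ (negative roots); $\Phi$ is the disjoint union of $\Phi^+$ and $\Phi^-$. Let $T=\bigcup_{w\in W}wSw^{-1}$ (reflections).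 For $x\in\Phi$, $r_x\in T$ is the element acting by $v\mapsto v-2(v,x)x$. For $t\in T$, $\alpha_t$ is the unique positive root with $r_{\alpha_t}=t$. Reflection subgroups. A subgroup $W'$ of $W$ is a reflection subgroup if $W'=\langle W'\cap T\rangle$. For $w\in W$ put $\overline N(w)=\{t\in T\mid \ell(wt)<\ell(w)\}$. For a reflection subgroup $W'$ let $S(W')=\{t\in T\mid \overline N(t)\cap W'=\{t\}\}$ and $\Delta(W')=\{x\in\Phi^+\mid r_x\in S(W')\}$. Then $(W',S(W'))$ is a Coxeter system, with length function $\ell_{(W',S(W'))}$. $W'$ is a dihedral reflection subgroup if $\#S(W')=2$. Infinity height. Let $\mathscr M$ be the set of maximal (under inclusion) dihedral reflection subgroups of $W$, $\mathscr M_\infty$ the set of infinite members of $\mathscr M$, and $\mathscr M_t=\{W'\in\mathscr M\mid t\in W'\}$ for $t\in T$. For a reflection subgroup $W'$ and $t\in W'\cap T$, $h_{(W',S(W'))}(t)=\min\{\ell_{(W',S(W'))}(w)\mid w\in W',\ w\alpha_t\in\Delta(W')\}$. The $\infty$-height of $t\in T$ is $h^\infty(t)=\sum_{W'\in\mathscr M_t\cap\mathscr M_\infty}h_{(W',S(W'))}(t)$ (only finitely many terms are nonzero), and for each non-negative integer $n$, $T_n=\{t\in T\mid h^\infty(t)=n\}$. *)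

(* Defs.v *)
From HB Require Import structures.
From mathcomp Require Import all_boot all_order all_algebra finmap.
From mathcomp Require Import all_classical all_reals all_analysis.

Set Implicit Arguments.
Unset Strict Implicit.
Unset Printing Implicit Defensive.

Import Order.TTheory GRing.Theory Num.Theory.

Local Open Scope classical_set_scope.
Local Open Scope ring_scope.

(* Junk value 0 on the empty set. *)
Definition nat_min (P : set nat) : nat :=
  xget 0%N [set n | P n /\ forall m, P m -> (n <= m)%N].

Section Subgroups.
Variable W : groupType.
Implicit Types (H A : set W) (w : W).

Definition is_subgroup H : Prop :=
  [/\ H 1%g, (forall x y, H x -> H y -> H (x * y)%g)
    & forall x, H x -> H (x^-1)%g].

Definition generated A : set W :=
  [set w | forall H, is_subgroup H -> A `<=` H -> H w].

(* Words use letters of [A] only, without inverses: this is applied to sets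
   of involutions. *)
Definition word_length A w : nat :=
  nat_min [set n | exists s : seq W,
    [/\ size s = n, (forall x, x \in s -> A x) & w = (\prod_(x <- s) x)%g]].

End Subgroups.

Section CoxeterDatum.
Variables (R : realType) (V : lmodType R) (B : {symmetric V}) (Delta : set V).

Definition PLC (A : set V) : set V :=
  [set v | exists (s : seq V) (c : V -> R),
    [/\ uniq s /\ (forall a, a \in s -> A a),
        forall a, a \in s -> 0 <= c a,
        exists2 a, a \in s & 0 < c a
      & v = \sum_(a <- s) c a *: a]].

Record root_basis : Prop := RootBasis {
  root_basis_norm : forall a, Delta a -> B a a = 1;
  root_basis_pair : forall a b, Delta a -> Delta b -> a <> b ->
    (exists2 m : nat, (2 <= m)%N & B a b = - cos (pi / m%:R)) \/ B a b <= -1;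
  root_basis_PLC : ~ PLC Delta 0
}.

(* The exponent m_ab for distinct a and b, with 0 encoding infinity; the
   integer m is determined by B a b, as m |-> cos (pi / m) is injective on
   m >= 2 and takes its values in [0, 1[. *)
Definition cox_exponent (a b : V) : nat :=
  xget 0%N [set m | (2 <= m)%N /\ B a b = - cos (pi / m%:R)].

Definition reflection (x v : V) : V := v - (2 * B v x) *: x.

Section CoxeterGroup.
Variables (W : groupType) (r : V -> W) (act : W -> V -> V).

(* The relation x ^+ 0 = 1 is vacuous, so infinite exponents impose nothing. *)
Definition cox_relations (G : groupType) (f : V -> G) : Prop :=
  (forall a, Delta a -> (f a * f a = 1)%g) /\
  (forall a b, Delta a -> Delta b -> a <> b ->
     ((f a * f b) ^+ cox_exponent a b = 1)%g).

Definition simple_refls : set W := r @` Delta.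

(* W is the group presented by the generators r a (a in Delta) and the Coxeter
   relations. Values of r outside Delta are irrelevant. *)
Record coxeter_system : Prop := CoxeterSystem {
  coxeter_system_rel : cox_relations r;
  coxeter_system_gen : generated simple_refls = [set: W];
  coxeter_system_univ : forall (G : groupType) (f : V -> G), cox_relations f ->
    exists phi : {multiplicative W -> G}, forall a, Delta a -> phi (r a) = f a
}.

(* By generation, there is at most one such action. *)
Record geometric_action : Prop := GeometricAction {
  geometric_action1 : forall v, act 1%g v = v;
  geometric_actionM : forall w1 w2 v, act (w1 * w2)%g v = act w1 (act w2 v);
  geometric_action_simple : forall a v, Delta a -> act (r a) v = reflection a v
}.

Definition cox_length : W -> nat := word_length simple_refls.

Definition roots : set V :=
  [set x | exists w a, Delta a /\ x = act w a].

Definition pos_roots : set V := roots `&` PLC Delta.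

Definition refls : set W :=
  [set t | exists w s, simple_refls s /\ t = (w * s * w^-1)%g].

(* The element r_x, for x a root; unique since the action is faithful. *)
Definition refl_of_root (x : V) : W :=
  xget 1%g [set t | refls t /\ forall v, act t v = reflection x v].

(* The positive root alpha_t, for t a reflection. *)
Definition root_of_refl (t : W) : V :=
  xget 0 [set x | pos_roots x /\ refl_of_root x = t].

Definition Nbar (w : W) : set W :=
  [set t | refls t /\ (cox_length (w * t)%g < cox_length w)%N].

Definition reflection_subgroup (W' : set W) : Prop :=
  is_subgroup W' /\ W' = generated (W' `&` refls).

Definition canonical_gens (W' : set W) : set W :=
  [set t | refls t /\ Nbar t `&` W' = [set t]].

Definition canonical_roots (W' : set W) : set V :=
  [set x | pos_roots x /\ canonical_gens W' (refl_of_root x)].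

Definition dihedral (W' : set W) : Prop :=
  reflection_subgroup W' /\ (canonical_gens W' #= `I_2)%card.

Definition maximal_dihedral : set (set W) :=
  [set W' | dihedral W' /\
     forall W'', dihedral W'' -> W' `<=` W'' -> W'' = W'].

Definition height (W' : set W) (t : W) : nat :=
  nat_min [set n | exists w, [/\ W' w,
    canonical_roots W' (act w (root_of_refl t))
    & n = word_length (canonical_gens W') w]].

(* A sum over the finite support of its general term. *)
Definition inf_height (t : W) : nat :=
  (\sum_(W' \in [set W' | [/\ maximal_dihedral W', infinite_set W' & W' t]])
     height W' t)%R.

Definition refls_of_height (n : nat) : set W :=
  [set t | refls t /\ inf_height t = n].

End CoxeterGroup.
End CoxeterDatum.

(* Main.v *)
(* The infinity-height of a reflection t is the number of positive roots strictly
   dominated by alpha_t, where x dominates y if every w in W making x negative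
   makes y negative. Indeed x <> y are comparable for dominance exactly when
   B x y >= 1; then r_x and r_y lie in a unique maximal dihedral reflection
   subgroup W', the one of the plane spanned by x and y, which is infinite, and
   the height of r_x in W' counts the roots of W' that x dominates.

   (i) If x dominates some other root, let y be a minimal such root, so that r_y
   is in T_0. Then z = r_y x is a positive root dominating strictly fewer roots
   than x, and r_x = r_y r_z r_y.

   (ii) The root z in (i) dominates some y' with r_y' in T_0, and y' <> y, so each
   z occurs with at most #T_0 - 1 roots y; hence the number of reflections of
   infinity-height at most n is at most (#T_0)^(n+1), and the bound on #T_n
   follows. Every n is attained, because the number of dominated roots changes by
   at most one along a descent to a simple root, and because T is infinite. The
   finiteness of T_0 is the theorem of Brink and Howlett: the inner products of
   pairs of roots in ]-1, 1[ form a finite set, as such pairs lie in a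
   conjugate of a finite parabolic subsystem; so the vectors of inner products
   with the simple roots, clipped at -1, take finitely many values on T_0, and
   they are pairwise distinct along any chain of elementary roots starting from a
   simple root, which bounds the length of such a chain. *)

Require Import Defs.
From HB Require Import structures.
From mathcomp Require Import all_boot all_order all_algebra finmap.
From mathcomp Require Import all_classical all_reals all_analysis.
From mathcomp Require Import perm ring lra zify.

Set Implicit Arguments.
Unset Strict Implicit.
Unset Printing Implicit Defensive.

Import Order.TTheory GRing.Theory Num.Theory.

Local Open Scope classical_set_scope.
Local Open Scope ring_scope.

(** * Linear combinations *)

(** [Delta] may be linearly dependent and the form degenerate, so the coefficients of a root are not
    determined by it. The usual comparison of signs of coefficients is replaced by exhibiting 0 as a
    combination of elements of [Delta] with nonnegative coefficients, some of them positive, against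
    (C2). For the same reason a linear functional positive on [Delta] is not given by coordinates:
    it comes from Gordan's theorem. In rank two everything rests on the recurrence
    [v (n+2) = 2k v (n+1) - v n]. For [k >= 1] its coefficients increase strictly, which gives
    infinitely many roots; for [k < 1] they change sign, so that the terms cannot all be positive.
    This dichotomy replaces the classification of rank two subgroups: it yields both [1 <= B x y]
    for comparable positive roots and the finite order of [rr x * rr y] for [-1 < B x y < 1],
    without first knowing that [B x y] is the cosine of a rational multiple of pi. *)

Section VectorExpressions.
Variables (R : comPzRingType) (V : lmodType R).

Inductive vexpr :=
  | VVar of nat | VZero | VAdd of vexpr & vexpr | VOpp of vexpr
  | VScale of R & vexpr.

Fixpoint vexpr_eval (env : seq V) e : V :=
  match e with
  | VVar i => nth 0 env i
  | VZero => 0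
  | VAdd e1 e2 => vexpr_eval env e1 + vexpr_eval env e2
  | VOpp e1 => - vexpr_eval env e1
  | VScale c e1 => c *: vexpr_eval env e1
  end.

Fixpoint vexpr_coef i e : R :=
  match e with
  | VVar j => (i == j)%:R
  | VZero => 0
  | VAdd e1 e2 => vexpr_coef i e1 + vexpr_coef i e2
  | VOpp e1 => - vexpr_coef i e1
  | VScale c e1 => c * vexpr_coef i e1
  end.

Lemma vexpr_evalE env e :
  vexpr_eval env e = \sum_(i < size env) vexpr_coef i e *: nth 0 env i.
Proof.
elim: e => [j||e1 IH1 e2 IH2|e1 IH1|c e1 IH1] /=.
- have [jlt|jge] := ltnP j (size env).
    rewrite (bigD1 (Ordinal jlt)) //= eqxx scale1r big1 ?addr0 // => i.
    by rewrite -val_eqE /= => /negPf ->; rewrite scale0r.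
  rewrite nth_default // big1 // => i _; case: eqP => [ij|_]; last first.
    by rewrite scale0r.
  by have := ltn_ord i; rewrite ij ltnNge jge.
- by rewrite big1 // => i _; rewrite scale0r.
- by rewrite IH1 IH2 -big_split; apply: eq_bigr => i _; rewrite scalerDl.
- by rewrite IH1 -sumrN; apply: eq_bigr => i _; rewrite scaleNr.
- by rewrite IH1 scaler_sumr; apply: eq_bigr => i _; rewrite scalerA.
Qed.

(** Computed by recursion, so that for a concrete environment it unfolds to a conjunction with one
    scalar identity per atom. *)
Fixpoint coefs_eq n e1 e2 : Prop :=
  if n is n'.+1 then
    vexpr_coef n' e1 = vexpr_coef n' e2 /\ coefs_eq n' e1 e2
  else True.

Lemma vexpr_eq env e1 e2 :
  coefs_eq (size env) e1 e2 -> vexpr_eval env e1 = vexpr_eval env e2.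
Proof.
move=> h; rewrite !vexpr_evalE; apply: eq_bigr => -[i /= ilt] _; congr (_ *: _).
elim: (size env) ilt h => //= n IH; rewrite ltnS leq_eqVlt.
by case/orP => [/eqP -> []|/IH h [_ /h]].
Qed.

End VectorExpressions.
Arguments VZero {R}.
Arguments VVar {R}.

(* Proves an equation between linear combinations of vectors by reducing it to
   one ring identity per vector. *)
Ltac vec_mem v l :=
  lazymatch l with
  | nil => constr:(false)
  | cons v _ => constr:(true)
  | cons _ ?l' => vec_mem v l'
  end.
Ltac vec_add v l :=
  lazymatch vec_mem v l with
  | true => l
  | false => constr:(cons v l)
  end.
Ltac vec_index v l :=
  lazymatch l with
  | cons v _ => constr:(O)
  | cons _ ?l' => let n := vec_index v l' in constr:(S n)
  end.
Ltac vec_atoms t l :=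
  lazymatch t with
  | (?a + ?b)%R => let l := vec_atoms a l in vec_atoms b l
  | (- ?a)%R => vec_atoms a l
  | (_ *: ?a)%R => vec_atoms a l
  | 0%R => l
  | _ => vec_add t l
  end.
Ltac vec_reify Rt t l :=
  lazymatch t with
  | (?a + ?b)%R => let a := vec_reify Rt a l in let b := vec_reify Rt b l in
                   constr:(@VAdd Rt a b)
  | (- ?a)%R => let a := vec_reify Rt a l in constr:(@VOpp Rt a)
  | (?c *: ?a)%R => let a := vec_reify Rt a l in constr:(@VScale Rt c a)
  | 0%R => constr:(@VZero Rt)
  | _ => let n := vec_index t l in constr:(@VVar Rt n)
  end.
Ltac vec_with Rt :=
  lazymatch goal with
  | |- @eq ?T ?a ?b =>
    let l := vec_atoms a (@nil T) in
    let l := vec_atoms b l in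
    let ea := vec_reify Rt a l in
    let eb := vec_reify Rt b l in
    apply: (@vexpr_eq Rt _ l ea eb);
    cbn [coefs_eq vexpr_coef size eqn]; repeat split;
    rewrite ?eqxx /=
  end.

Ltac vec :=
  match goal with Rt : realType |- _ => vec_with Rt; try ring end.

(** * Cones, Chebyshev recurrences and Gordan's theorem *)

Section Cones.
Variables (R : realType) (V : lmodType R).
Implicit Types (A : set V) (u v a : V).

(** The vectors [f t] may repeat, while [PLC] asks for a duplicate-free list: coefficients of equal
    vectors are added up. *)
Lemma PLC_sum A (T : choiceType) (s : seq T) (f : T -> V) (c : T -> R) :
  (forall t, t \in s -> A (f t)) -> (forall t, t \in s -> 0 <= c t) ->
  (exists2 t, t \in s & 0 < c t) -> PLC A (\sum_(t <- s) c t *: f t).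
Proof.
move=> sA c0 [t0 t0s ct0].
pose d v := \sum_(t <- s | f t == v) c t.
exists (undup (map f s)), d; split.
- split; first exact: undup_uniq.
  by move=> a; rewrite mem_undup => /mapP[t /sA ? ->].
- by move=> a _; rewrite /d big_seq_cond sumr_ge0 // => t /andP[/c0].
- exists (f t0); first by rewrite mem_undup map_f.
  rewrite /d; case/splitPr: t0s c0 => s1 s2 c0;
    rewrite big_cat /= big_cons ifT //.
  rewrite addrCA ltr_pwDl // addr_ge0 //;
    rewrite big_seq_cond sumr_ge0 // => t /andP[ts _]; apply: c0;
    by rewrite mem_cat inE ts ?orbT.
- transitivity (\sum_(v <- undup (map f s)) \sum_(t <- s | f t == v) c t *: f
    t).
    rewrite (exchange_big_dep xpredT) //= [LHS]big_seq [RHS]big_seq.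
    apply: eq_bigr => t ts; rewrite -big_filter.
    rewrite (_ : [seq _ <- _ | _] = [:: f t]) ?big_seq1 //.
    rewrite (eq_filter (a2 := pred1 (f t))) => [|v]; last by rewrite /= eq_sym.
    by rewrite filter_pred1_uniq ?undup_uniq // mem_undup map_f.
  apply: eq_bigr => v _; rewrite /d scaler_suml.
  by apply: eq_bigr => t /eqP ->.
Qed.

Lemma PLC_mem A a : A a -> PLC A a.
Proof.
move=> Aa; rewrite -[a]scale1r -[_ *: _](big_seq1 +%R a (fun a => 1 *: a)).
apply: (PLC_sum (c := fun=> 1) (f := id)) => [t|t|].
- by rewrite inE => /eqP ->.
- by rewrite ler01.
- by exists a; rewrite ?inE ?ltr01.
Qed.

Lemma PLC_scale A c v : 0 < c -> PLC A v -> PLC A (c *: v).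
Proof.
move=> c0 [s [d [[us sA] d0 [a as_ da] ->]]]; rewrite scaler_sumr.
under eq_bigr do rewrite scalerA.
apply: (PLC_sum (f := id)) => // [t ts|].
  by apply: mulr_ge0; [exact: ltW|exact: d0].
by exists a => //; rewrite mulr_gt0.
Qed.

Lemma PLC_add A u v : PLC A u -> PLC A v -> PLC A (u + v).
Proof.
move=> [s [d [[us sA] d0 [a as_ da] ->]]] [s' [d' [[us' sA'] d0' [a' as_' da']
  ->]]].
pose f (p : V * bool) := p.1; pose c (p : V * bool) := if p.2 then d p.1 else
  d' p.1.
have -> : \sum_(a <- s) d a *: a + \sum_(a <- s') d' a *: a =
   \sum_(p <- [seq (a, true) | a <- s] ++ [seq (a, false) | a <- s']) c p *: f
     p.
  by rewrite big_cat /= !big_map.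
apply: PLC_sum.
- by move=> t; rewrite mem_cat => /orP[] /mapP[x xs ->]; [exact: sA|exact: sA'].
- by move=> t; rewrite mem_cat => /orP[] /mapP[x xs ->]; [exact: d0|exact: d0'].
- by exists (a, true) => //; rewrite mem_cat map_f.
Qed.

(** Coefficients may be zero, so a partial sum either vanishes or satisfies [P]; splitting off the
    term with a positive coefficient rules out the first case for the whole sum. *)
Lemma PLC_ind A (P : V -> Prop) :
  (forall c a, 0 < c -> A a -> P (c *: a)) ->
  (forall u v, P u -> P v -> P (u + v)) -> forall v, PLC A v -> P v.
Proof.
move=> P1 PD v [s [c [[_ sA] c0 [a as_ ca] ->]]].
have h s' : {subset s' <= s} -> 
  \sum_(a <- s') c a *: a = 0 \/ P (\sum_(a <- s') c a *: a).
  elim: s' => [|b s' IH] sub; first by left; rewrite big_nil.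
  have bs : b \in s by apply: sub; rewrite mem_head.
  have sub' : {subset s' <= s} by move=> t ts; apply: sub; rewrite inE ts orbT.
  rewrite big_cons; case: (IH sub') => [->|Ps].
  - have := c0 b bs; rewrite le_eqVlt => /orP[/eqP <-|cb].
      by left; rewrite scale0r addr0.
    by right; rewrite addr0; apply: P1 => //; apply: sA.
  - have := c0 b bs; rewrite le_eqVlt => /orP[/eqP <-|cb].
      by right; rewrite scale0r add0r.
    by right; apply: PD => //; apply: P1 => //; apply: sA.
have Pa : P (c a *: a) by apply: P1 => //; apply: sA.
case/splitPr: as_ h {sA c0} => s1 s2 h; rewrite big_cat big_cons /= addrCA.
have h1 : {subset s1 <= s1 ++ a :: s2} by move=> t; rewrite mem_cat => ->.
have h2 : {subset s2 <= s1 ++ a :: s2}.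
  by move=> t; rewrite mem_cat inE => ->; rewrite !orbT.
case: (h _ h1) => [->|P1s]; case: (h _ h2) => [->|P2s];
  rewrite ?addr0 ?add0r //.
- exact: PD.
- exact: PD.
- by apply: (PD _ _ Pa); apply: PD.
Qed.

Definition cone A v := v = 0 \/ PLC A v.

Lemma cone_PLC A v : PLC A v -> cone A v. Proof. by right. Qed.

Lemma cone_add A u v : cone A u -> cone A v -> cone A (u + v).
Proof.
move=> [->|u0] [->|v0]; rewrite ?addr0 ?add0r; [by left|by right|by right|].
by right; apply: PLC_add.
Qed.

Lemma PLC_cone_add A u v : PLC A u -> cone A v -> PLC A (u + v).
Proof. by move=> u0 [->|v0]; rewrite ?addr0 //; apply: PLC_add. Qed.

Lemma cone_scale A c v : 0 <= c -> cone A v -> cone A (c *: v).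
Proof.
rewrite le_eqVlt => /orP[/eqP <-|c0]; first by rewrite scale0r; left.
by move=> [->|v0]; [left; rewrite scaler0|right; apply: PLC_scale].
Qed.

(** The final disjunction preserves the strictness in [PLC]: a positive coefficient sits either at
    [a] or in the rest. *)
Lemma PLC_split A a v : A a -> PLC A v ->
  exists c w, [/\ 0 <= c, cone (A `\ a) w, v = c *: a + w & 0 < c \/ PLC (A `\
    a) w].
Proof.
move=> Aa; elim/PLC_ind => [c b c0 Ab|u1 u2 [c1 [w1 [c10 w10 -> h1]]] [c2 [w2
  [c20 w20 -> h2]]]].
  have [->|ba] := pselect (b = a).
    by exists c, 0; rewrite addr0; split; rewrite ?ltW //; left.
  have Pb : PLC (A `\ a) (c *: b) by apply: PLC_scale => //; apply: PLC_mem.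
  by exists 0, (c *: b); rewrite scale0r add0r; split => //; right.
exists (c1 + c2), (w1 + w2); split.
- exact: addr_ge0.
- exact: cone_add.
- by vec.
- case: h1 => [c1gt|w1P]; first by left; rewrite ltr_pwDl.
  by right; apply: PLC_cone_add.
Qed.

Lemma PLC_sub A A' v : A `<=` A' -> PLC A v -> PLC A' v.
Proof.
move=> sub; elim/PLC_ind => [c a c0 Aa|]; last exact: PLC_add.
by apply: PLC_scale => //; apply: PLC_mem; apply: sub.
Qed.

End Cones.

Section Chebyshev.
Variable R : realType.
Implicit Types (k : R) (n : nat).

(* Values U_{n-1}(k) of the Chebyshev polynomials of the second kind. *)
Fixpoint cheb k n : R :=
  match n with
  | 0 => 0
  | n1.+1 => match n1 with 0 => 1 | n2.+1 => 2 * k * cheb k n1 - cheb k n2 end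
  end.

Lemma chebSS k n : cheb k n.+2 = 2 * k * cheb k n.+1 - cheb k n.
Proof. by []. Qed.

Lemma cheb_incr k n : 1 <= k -> 0 <= cheb k n < cheb k n.+1.
Proof.
move=> k1; elim: n => [|n /andP[un ltn]]; first by rewrite /= lexx ltr01.
rewrite chebSS; apply/andP; split; nra.
Qed.

Lemma cheb_ge0 k n : 1 <= k -> 0 <= cheb k n.
Proof. by move=> /(cheb_incr n)/andP[]. Qed.

Lemma cheb_mono k m n : 1 <= k -> (m < n)%N -> cheb k m < cheb k n.
Proof.
move=> k1; elim: n => // n IH; rewrite ltnS leq_eqVlt => /orP[/eqP ->|/IH h].
  by case/andP: (cheb_incr n k1).
by apply: (lt_trans h); case/andP: (cheb_incr n k1).
Qed.

Lemma cheb_inj k m n : 1 <= k -> cheb k m = cheb k n -> m = n.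
Proof.
move=> k1 e; case: (ltngtP m n) => // /(cheb_mono k1); by rewrite e ltxx.
Qed.

(** For [k = cos t] the value is [sin (n t) / sin t], and [n t] stays in [0, pi] when [t = pi / m]
    and [n <= m]. *)
Lemma cheb_sin m n : (2 <= m)%N -> (n <= m)%N -> 0 <= cheb (cos (pi / m%:R) :
  R) n.
Proof.
move=> m2 nm; set t : R := pi / m%:R.
have m0 : 0 < m%:R :> R by rewrite ltr0n; apply: leq_trans m2.
have t0 : 0 < t by rewrite divr_gt0 // pi_gt0.
have tpi : t < pi.
  by rewrite ltr_pdivrMr // -[X in X < _]mulr1 ltr_pM2l ?pi_gt0 // ltr1n.
have st : 0 < sin t by apply: sin_gt0_pi; rewrite t0 tpi.
have h : forall n, cheb (cos t) n * sin t = sin (n%:R * t) /\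
    cheb (cos t) n.+1 * sin t = sin (n.+1%:R * t).
  elim=> [|p [IH1 IH2]]; first by rewrite /= !mul0r sin0 !mul1r.
  split => //; rewrite chebSS.
  have -> : (2 * cos t * cheb (cos t) p.+1 - cheb (cos t) p) * sin t =
     2 * cos t * (cheb (cos t) p.+1 * sin t) - cheb (cos t) p * sin t by ring.
  rewrite IH1 IH2.
  have -> : p.+2%:R * t = p.+1%:R * t + t by rewrite -addn1 natrD mulrDl mul1r.
  have -> : p%:R * t = p.+1%:R * t - t by rewrite -addn1 natrD mulrDl mul1r
    addrK.
  rewrite sinB sinD; ring.
have := (h n).1; have : 0 <= sin (n%:R * t).
  apply: sin_ge0_pi; apply/andP; split; first by rewrite mulr_ge0 // ltW.
  by rewrite /t mulrA ler_pdivrMr // mulrC ler_pM2l ?pi_gt0 // ler_nat.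
by move=> h1 h2; move: h1; rewrite -h2 pmulr_lge0.
Qed.

Lemma natr_unbounded (x : R) : exists j : nat, x < j%:R.
Proof.
exists (Num.Def.archi_bound `|x|).
exact: le_lt_trans (ler_norm x) (archi_boundP (normr_ge0 x)).
Qed.

(* The sequence would be positive and concave, with increments dropping by a
   fixed amount at each step. *)
Lemma cheb_sign_change k : k < 1 ->
  exists2 n, 0 < cheb k n.+1 & cheb k n.+2 <= 0.
Proof.
move=> k1; apply: contrapT => h.
have pos n : 0 < cheb k n.+1.
  elim: n => [|n IH]; first by rewrite /= ltr01.
  by rewrite ltNge; apply/negP => ?; apply: h; exists n.
pose d n := cheb k n.+1 - cheb k n.
have dS n : d n.+1 = d n - 2 * (1 - k) * cheb k n.+1.
  by rewrite /d chebSS; ring.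
have d_le m n : (m <= n)%N -> d n <= d m.
  elim: n => [|n IH]; first by rewrite leqn0 => /eqP ->.
  rewrite leq_eqVlt ltnS => /orP[/eqP -> //|/IH]; rewrite dS.
  have := pos n; nra.
(* Increments never grow, so a negative one would persist and drive the values below 0. *)
have d_ge0 n : 0 <= d n.
  rewrite leNgt; apply/negP => dn.
  have bound j : cheb k (n + j)%N <= cheb k n + j%:R * d n.
    elim: j => [|j IH]; first by rewrite addn0 mul0r addr0.
    have := d_le n (n + j)%N (leq_addr _ _); rewrite {1}/d addnS -natr1.
    lra.
  have [j hj] : exists j : nat, cheb k n / - d n < j%:R by exact:
    natr_unbounded.
  move: hj; rewrite ltr_pdivrMr; last lra.
  have := bound j.+1; have := pos (n + j)%N; rewrite -addnS -natr1.
  lra.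
have ge1 n : 1 <= cheb k n.+1.
  elim: n => [|n IH]; first by rewrite /=.
  by have := d_ge0 n.+1; rewrite /d; lra.
have d_le' n : d n <= 1 - n%:R * (2 * (1 - k)).
  elim: n => [|n IH]; first by rewrite /d /=; lra.
  rewrite dS -natr1; have := ge1 n; nra.
have [j hj] : exists j : nat, (2 * (1 - k))^-1 < j%:R by exact: natr_unbounded.
have k0 : 0 < 2 * (1 - k) by lra.
move: hj; rewrite -[_^-1]div1r ltr_pdivrMr // => hj.
by have := d_le' j; have := d_ge0 j; lra.
Qed.

End Chebyshev.

Section Gordan.
Variable R : realType.
Implicit Types (K : (nat -> R) -> Prop) (u v k phi psi : nat -> R) (n : nat).

(* Subspaces of R^n, with vectors represented by sequences whose entries from
   index n on are ignored. *)
Definition subspace n K := [/\ K (fun=> 0),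
  (forall c u v, K u -> K v -> K (fun i => u i + c * v i)) &
  (forall u v, (forall i, (i < n)%N -> u i = v i) -> K u -> K v)].

Definition pairing n phi u : R := \sum_(i < n) phi i * u i.

Definition upd n u (t : R) : nat -> R := fun i => if i == n then t else u i.

Lemma pairing_lin n phi c u v :
  pairing n phi (fun i => u i + c * v i) = pairing n phi u + c * pairing n phi
    v.
Proof.
rewrite /pairing mulr_sumr -big_split; apply: eq_bigr => i _ /=; ring.
Qed.

Lemma pairing_linl n phi c psi u :
  pairing n (fun i => phi i + c * psi i) u = pairing n phi u + c * pairing n
    psi u.
Proof.
rewrite /pairing mulr_sumr -big_split; apply: eq_bigr => i _ /=; ring.
Qed.

Lemma pairing_upd n phi t u :
  pairing n.+1 (upd n phi t) u = pairing n phi u + t * u n.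
Proof.
rewrite /pairing big_ord_recr /= {2}/upd eqxx; congr (_ + _).
by apply: eq_bigr => i _; rewrite /upd ltn_eqF // ltn_ord.
Qed.

Lemma eq_pairing n phi u v : (forall i, (i < n)%N -> u i = v i) ->
  pairing n phi u = pairing n phi v.
Proof. by move=> h; apply: eq_bigr => i _; rewrite h // ltn_ord. Qed.

Definition slice n K : (nat -> R) -> Prop := fun u => K (upd n u 0).

Lemma subspace_slice n K : subspace n.+1 K -> subspace n (slice n K).
Proof.
move=> [K0 KD Ke]; split.
- by apply: Ke K0 => i _; rewrite /upd; case: eqP.
- move=> c u v Ku Kv; apply: Ke (KD c _ _ Ku Kv) => i _; rewrite /upd.
  by case: eqP => // _; rewrite mulr0 addr0.
- move=> u v e Ku; apply: Ke Ku => i; rewrite /upd ltnS leq_eqVlt.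
  by case: eqP => //= _ /e.
Qed.

Lemma slice_mem n K u : subspace n.+1 K -> u n = 0 -> slice n K u <-> K u.
Proof.
move=> [_ _ Ke] un; split; apply: Ke => i _; rewrite /upd;
  by case: eqP => // ->.
Qed.

(** Induction on the dimension. If some [k] in [K] has last coordinate 1, subtracting multiples of
    [k] reduces to the slice, and the functional found there is extended so as to vanish at [k].
    Otherwise all of [K] has last coordinate 0. *)
Lemma separate n K v : subspace n K -> ~ K v ->
  exists psi, (forall u, K u -> pairing n psi u = 0) /\ pairing n psi v <> 0.
Proof.
elim: n K v => [|n IH] K v sK nKv.
  by case: nKv; case: sK => K0 _ Ke; apply: Ke K0.
have [K0 KD Ke] := sK; have sK' := subspace_slice sK.
have [[k Kk kn]|h] := pselect (exists2 k, K k & k n = 1); last first.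
  have un u : K u -> u n = 0.
    move=> Ku; apply/eqP; apply: contrapT => /negP un; apply: h.
    exists (fun i => 0 + (u n)^-1 * u i); first exact: KD.
    by rewrite add0r mulVf.
  have [vn|vn] := eqVneq (v n) 0; last first.
    exists (upd n (fun=> 0) 1); split=> [u /un|]; rewrite pairing_upd mul1r.
      by move=> ->; rewrite /pairing big1 ?addr0 // => i _; rewrite mul0r.
    by rewrite /pairing big1 ?add0r => [|i _]; [apply/eqP|rewrite mul0r].
  have [|psi [psiK psiv]] := IH _ v sK'; first by move=> /(slice_mem sK vn).
  exists (upd n psi 0); split=> [u Ku|]; rewrite pairing_upd mul0r addr0 //.
  by apply: psiK; apply/(slice_mem sK (un u Ku)).
have red u : slice n K (fun i => u i + (- u n) * k i) <-> K u.
  rewrite slice_mem //; last by rewrite kn mulr1 subrr.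
  split=> Ku; last exact: KD.
  by apply: Ke (KD (u n) _ _ Ku Kk) => i _ /=; ring.
have [|psi [psiK psiv]] := IH _ (fun i => v i + (- v n) * k i) sK'.
  by move/red.
exists (upd n psi (- pairing n psi k)); split=> [u /red/psiK|];
  rewrite pairing_upd.
  by rewrite pairing_lin => e; rewrite -[RHS]e; ring.
by move: psiv; rewrite pairing_lin => psiv e; apply: psiv; rewrite -[RHS]e;
  ring.
Qed.

Lemma small_perturbation n phi psi : (forall i, (i < n)%N -> 0 < phi i) ->
  exists2 e, 0 < e & forall i, (i < n)%N -> 0 < phi i + e * psi i.
Proof.
elim: n => [|n IH] h; first by exists 1.
have [|e e0 he] := IH; first by move=> i /ltnW; apply: h.
pose e' := phi n / (2 * (`|psi n| + 1)).
have pn : 0 < phi n by apply: h.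
have q0 : 0 < `|psi n| + 1 by rewrite ltr_wpDl.
have e'0 : 0 < e' by rewrite divr_gt0 // mulr_gt0.
have hn : 0 < phi n + e' * psi n.
  have : e' * (`|psi n| + 1) = phi n / 2.
    by rewrite /e'; field; rewrite lt0r_neq0.
  have := ler_norm (- psi n); rewrite normrN; nra.
exists (Num.min e e'); first by rewrite lt_min e0.
have le1 : Num.min e e' <= e by rewrite ge_min lexx.
have le2 : Num.min e e' <= e' by rewrite ge_min lexx orbT.
have m0 : 0 < Num.min e e' by rewrite lt_min e0.
move: (Num.min e e') le1 le2 m0 => m le1 le2 m0 i.
rewrite ltnS leq_eqVlt => /orP[/eqP -> {i}|ilt].
  have [p0|p0] := leP 0 (psi n); nra.
have := he i ilt; have := h i (ltnW ilt).
have [p0|p0] := leP 0 (psi i); nra.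
Qed.

Lemma pairing_gt0 n phi u : (forall i, (i < n)%N -> 0 < phi i) ->
  (forall i, (i < n)%N -> 0 <= u i) -> (exists2 i, (i < n)%N & u i <> 0) ->
  0 < pairing n phi u.
Proof.
move=> ph u0 [j jn uj]; rewrite /pairing (bigD1 (Ordinal jn)) //=.
rewrite ltr_pwDl //; last first.
  by apply: sumr_ge0 => i _; rewrite mulr_ge0 // ?u0 ?ltW ?ph.
by rewrite mulr_gt0 ?ph // lt_neqAle u0 // eq_sym andbT; apply/eqP.
Qed.

(* Stiemke's variant of Gordan's theorem. *)
Theorem gordan n K : subspace n K ->
  (forall u, K u -> (forall i, (i < n)%N -> 0 <= u i) -> forall i, (i < n)%N ->
    u i = 0) ->
  exists2 phi, (forall i, (i < n)%N -> 0 < phi i) & forall u, K u -> pairing n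
    phi u = 0.
Proof.
elim: n K => [|n IH] K sK hK.
  by exists (fun=> 1) => // u _; rewrite /pairing big_ord0.
have [K0 KD Ke] := sK; have sK' := subspace_slice sK.
have [|phi0 phi0P phi0K] := IH _ sK'.
  move=> u Ku u0 i ilt.
  have := hK _ Ku _ i (ltnW ilt); rewrite /upd (ltn_eqF ilt); apply.
  by move=> j; rewrite ltnS leq_eqVlt; case: eqP => //= _ /u0.
have updP phi t : (forall i, (i < n)%N -> 0 < phi i) -> 0 < t ->
    forall i, (i < n.+1)%N -> 0 < upd n phi t i.
  by move=> ph t0 i; rewrite /upd ltnS leq_eqVlt; case: eqP => //= _ /ph.
have [[k Kk kn]|h] := pselect (exists2 k, K k & k n = 1); last first.
  exists (upd n phi0 1); first exact: updP.
  have un u : K u -> u n = 0.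
    move=> Ku; apply/eqP; apply: contrapT => /negP un; apply: h.
    exists (fun i => 0 + (u n)^-1 * u i); first exact: KD.
    by rewrite add0r mulVf.
  move=> u Ku; rewrite pairing_upd un // mulr0 addr0; apply: phi0K.
  by apply/(slice_mem sK (un u Ku)).
have red u : K u -> slice n K (fun i => u i + (- u n) * k i).
  move=> Ku; rewrite slice_mem //; last by rewrite kn mulr1 subrr.
  exact: KD.
(* It remains to find a positive functional that vanishes on the slice and is negative at [k]: the
   last coordinate that makes it vanish at [k] is then positive. *)
have extend phi : (forall i, (i < n)%N -> 0 < phi i) ->
    (forall u, slice n K u -> pairing n phi u = 0) -> pairing n phi k < 0 ->
    exists2 phi, (forall i, (i < n.+1)%N -> 0 < phi i) & forall u, K u ->
      pairing n.+1 phi u = 0.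
  move=> ph phK phk; exists (upd n phi (- pairing n phi k)).
    by apply: updP => //; rewrite oppr_gt0.
  move=> u /red/phK; rewrite pairing_lin pairing_upd => e; rewrite -[RHS]e;
    ring.
(* The projection of [K] to the first [n] coordinates. *)
pose K1 u := exists t, K (upd n u t).
have sK1 : subspace n K1.
  split.
  - by exists 0; apply: Ke K0 => i _; rewrite /upd; case: eqP.
  - move=> c u v [t Ku] [t' Kv]; exists (t + c * t').
    by apply: Ke (KD c _ _ Ku Kv) => i _; rewrite /upd; case: eqP.
  - move=> u v e [t Ku]; exists t; apply: Ke Ku => i;
      rewrite /upd ltnS leq_eqVlt.
    by case: eqP => //= _ /e.
have K1k : K1 k.
  by exists 1; apply: Ke Kk => i _; rewrite /upd; case: eqP => [->|].
have [hK1|] := pselect (forall u, K1 u -> (forall i, (i < n)%N -> 0 <= u i) ->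
    forall i, (i < n)%N -> u i = 0); last first.
  move=> /existsNP[u /not_implyP[[t Ku] /not_implyP[u0 une]]].
  have une' : exists2 i, (i < n)%N & u i <> 0.
    by apply: contrapT => h; apply: une => i ilt; apply: contrapT => ui;
      apply: h; exists i.
  (* The last coordinate [t] over a nonzero nonnegative [u] is negative by [hK]. As [phi0] vanishes
     on [u - t k] and is positive at [u], it is negative at [k]. *)
  apply: (extend phi0) => //.
  have t0 : t < 0.
    rewrite ltNge; apply/negP => t0; have [i ilt ui] := une'; apply: ui.
    have := hK _ Ku _ i (ltnW ilt); rewrite /upd (ltn_eqF ilt); apply.
    by move=> j; rewrite ltnS leq_eqVlt; case: eqP => //= _ /u0.
  have := phi0K _ (red _ Ku); rewrite pairing_lin /upd eqxx.
  rewrite (@eq_pairing n phi0 _ u); last by move=> i /ltn_eqF ->.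
  by have := pairing_gt0 phi0P u0 une'; nra.
have [phi1 phi1P phi1K] := IH _ sK1 hK1.
(* Here [phi1] vanishes on the whole projection, including [k]; perturbing it slightly by a
   functional that separates [k] from the slice makes it negative at [k] and keeps it positive. Were
   [k] in the slice, the last unit vector would lie in [K]. *)
have nk : ~ slice n K k.
  move=> Kk'; have := hK _ (KD (-1) _ _ Kk Kk') _ n (ltnSn n).
  rewrite /upd eqxx kn mulr0 addr0 => e; suff : (1 : R) = 0 by move/eqP;
    rewrite oner_eq0.
  by apply: e => i _; case: eqP => [->|_]; [rewrite kn mulr0 addr0|rewrite
    mulN1r subrr].
have [psi [psiK psik]] := separate sK' nk.
have {psi psiK psik} [psi psiK psik] : exists2 psi,
    (forall u, slice n K u -> pairing n psi u = 0) & pairing n psi k < 0.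
  have [p0|p0] := ltP (pairing n psi k) 0; first by exists psi.
  have pN u : pairing n (fun i => 0 + (-1) * psi i) u = - pairing n psi u.
    by rewrite (pairing_linl n (fun=> 0)) mulN1r /pairing big1 ?add0r // => i
      _; rewrite mul0r.
  exists (fun i => 0 + (-1) * psi i); first by move=> u Ku;
    rewrite pN psiK ?oppr0.
  by rewrite pN oppr_lt0 lt_neqAle p0 andbT; apply/eqP => e; apply: psik.
have [e e0 he] := small_perturbation psi phi1P.
apply: (extend _ he) => [u Ku|].
  by rewrite pairing_linl phi1K ?psiK ?mulr0 ?addr0 //; exists 0.
by rewrite pairing_linl phi1K // add0r pmulr_rlt0.
Qed.

End Gordan.

(** * Finite sets and words *)

Section FiniteSets.
Implicit Types T U : choiceType.
Local Notation card A := (#|` fset_set A|).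

Lemma card_sub_le T (A C : set T) : finite_set C -> A `<=` C -> (card A <= card
  C)%N.
Proof.
move=> fC AC; have fA := sub_finite_set AC fC.
by apply: fsubset_leq_card; rewrite -fset_set_sub.
Qed.

Lemma card_sub_lt T (A C : set T) x : finite_set C -> A `<=` C -> C x -> ~ A x
  ->
  (card A < card C)%N.
Proof.
move=> fC AC Cx Ax; have fA := sub_finite_set AC fC.
apply: fproper_ltn_card; rewrite fproperE; apply/andP; split.
  by rewrite -fset_set_sub.
by apply/fsubsetPn; exists x; rewrite in_fset_set // ?inE // notin_setE.
Qed.

Lemma card_image_le T U (f : T -> U) (A : set T) : finite_set A ->
  (card (f @` A) <= card A)%N.
Proof. by move=> fA; rewrite fset_set_image // leq_imfset_card. Qed.

Lemma card_inj_le T U (f : T -> U) (A : set T) (C : set U) : finite_set C ->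
  (forall x, A x -> C (f x)) -> (forall x y, A x -> A y -> f x = f y -> x = y)
    ->
  finite_set A -> (card A <= card C)%N.
Proof.
move=> fC AC inj fA; have <- : card (f @` A) = card A.
  rewrite fset_set_image // card_in_imfset //= => x y.
  by rewrite !in_fset_set // !inE; apply: inj.
by apply: card_sub_le => // _ [x Ax <-]; apply: AC.
Qed.

Lemma card_subU1_le T (A C : set T) x : finite_set C -> A `\ x `<=` C ->
  (card A <= (card C).+1)%N.
Proof.
move=> fC AC; have fU : finite_set (x |` C) by rewrite finite_setU; split.
apply: leq_trans (card_sub_le (C := x |` C) fU _) _.
  by move=> y Ay; have [->|yx] := pselect (y = x); [left|right; apply: AC].
rewrite fset_setU1 // cardfsU1; by case: (_ \notin _).
Qed.

Lemma finite_nat_bound (A : set nat) : finite_set A -> exists n, forall m, A m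
  -> (m < n)%N.
Proof.
move=> fA; exists (\max_(m <- fset_set A) m).+1 => m Am; rewrite ltnS.
by apply: leq_bigmax_seq => //; rewrite in_fset_set // inE.
Qed.

Lemma finite_no_inj T (A : set T) (f : nat -> T) : finite_set A ->
  (forall n, A (f n)) -> injective f -> False.
Proof.
move=> fA Af inj; apply: infinite_nat.
by apply: sub_finite_set (finite_preimage (in2W inj) fA) => n _; apply: Af.
Qed.

Lemma finite_infinitely_often T (A : set T) (I : set nat) (f : nat -> T) :
  finite_set A -> (forall n, I n -> A (f n)) ->
  (forall n, exists2 m, (n <= m)%N & I m) ->
  exists i j, (i < j)%N /\ f i = f j.
Proof.
move=> fA IA unb; apply: contrapT => h.
have inj i j : f i = f j -> i = j.
  by move=> e; case: (ltngtP i j) => // ij; case: h; [exists i, j|exists j, i].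
have fI : finite_set I.
  apply: sub_finite_set (finite_preimage (in2W inj) fA); exact: IA.
have [n hn] := finite_nat_bound fI; have [m nm /hn] := unb n.
by rewrite ltnNge nm.
Qed.

(** [M] may be infinite: only the finitely many values of [g] on [D] contribute to the sum. *)
Lemma fsbig_card_fibers T U (D : set T) (M : set U) (g : T -> U) :
  finite_set D -> (forall y, D y -> M (g y)) ->
  (\sum_(m \in M) card [set y | D y /\ g y = m])%R = card D.
Proof.
move=> fD DM.
have fin m : finite_set [set y | D y /\ g y = m] by apply: sub_finite_set fD =>
  y [].
rewrite -(fsbig_widen (g @` D)).
- rewrite fsbig_finite; last exact: finite_image.
  transitivity (\sum_(m <- fset_set (g @` D)) \sum_(y <- fset_set D | g y == m)
    1)%N.
    apply: eq_bigr => m _; rewrite -big_filter sum1_size.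
    apply: perm_size; apply: uniq_perm; rewrite ?filter_uniq ?fset_uniq // => y.
    rewrite mem_filter !in_fset_set //; apply/idP/andP.
      by rewrite inE => -[Dy <-]; rewrite eqxx; split=> //; rewrite inE.
    by rewrite !inE => -[/eqP gy].
  rewrite (exchange_big_dep xpredT) //= big_seq.
  rewrite (eq_bigr (fun=> 1%N)); first by rewrite -big_seq sum1_size.
  move=> y; rewrite in_fset_set // inE => Dy.
  rewrite -big_filter sum1_size (eq_filter (a2 := pred1 (g y))) => [|m];
    last by rewrite /= eq_sym.
  rewrite filter_pred1_uniq ?fset_uniq // in_fset_set ?inE;
    last exact: finite_image.
  by exists y.
- by move=> _ [y Dy <-]; apply: DM.
- move=> m [_ /= h]; rewrite (_ : [set y | _] = set0) ?fset_set0 //.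
  by apply/seteqP; split=> // y [Dy gy]; apply: h; exists y.
Qed.

(** The factor [card C - 1] arises because each [z] in [A] excludes the partner [E z], itself a
    member of [C]. *)
Lemma card_pairs_le T U (A C : set T) (D : set U) (E : T -> T) (f : T -> T ->
  U) :
  finite_set A -> finite_set C -> (forall z, A z -> C (E z)) ->
  (forall d, D d -> exists y z, [/\ C y, A z, y <> E z & d = f y z]) ->
  finite_set D /\ (card D <= card A * (card C - 1))%N.
Proof.
move=> fA fC AE Dd.
pose s := [seq f y z | z <- fset_set A, y <- (fset_set C `\ E z)%fset].
have sub : D `<=` [set` [fset x in s]%fset].
  move=> d /Dd[y [z [Cy Az yz ->]]]; rewrite /= inE /s; apply/allpairsPdep.
  exists z, y; split=> //; first by rewrite in_fset_set // inE.
  rewrite !inE in_fset_set //; apply/andP; split; first exact/eqP.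
  by rewrite inE.
have fD : finite_set D by apply: sub_finite_set sub _; apply: finite_fset.
split=> //; apply: (@leq_trans (size s)).
  apply: leq_trans (card_sub_le (finite_fset _) sub) _.
  by rewrite set_fsetK card_fseq size_undup.
rewrite size_allpairs_dep sumnE big_map big_seq.
rewrite (eq_bigr (fun=> (card C - 1)%N)).
  by rewrite -big_seq big_const_seq count_predT iter_addn_0 mulnC.
move=> z; rewrite in_fset_set // inE => /AE Cz.
by rewrite [in RHS](cardfsD1 (E z)) in_fset_set // mem_set // add1n subn1.
Qed.

Lemma finite_powerset T (A : set T) : finite_set A -> finite_set [set X : set T
  | X `<=` A].
Proof.
move=> fA; apply: (sub_finite_set (B := (fun X : {fset T} => [set` X]) @`
  [set` fpowerset (fset_set A)])); last by apply: finite_image;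
    apply: finite_fset.
move=> X XA; have fX := sub_finite_set XA fA.
by exists (fset_set X); rewrite /= ?fsetsE ?fset_setK // fpowersetE
  -fset_set_sub.
Qed.

Lemma finite_words T (A : set T) n : finite_set A ->
  finite_set [set s : seq T | size s = n /\ forall x, x \in s -> A x].
Proof.
move=> fA; elim: n => [|n IH].
  by apply: (sub_finite_set (B := [set [::]])) => // s [/size0nil].
apply: (sub_finite_set (B := (fun p => p.1 :: p.2) @`
  (A `*` [set s : seq T | size s = n /\ forall x, x \in s -> A x]))).
  move=> [|x s] [// [sz] sA]; exists (x, s) => //; split; first by apply: sA;
    rewrite mem_head.
  by split=> // y ys; apply: sA; rewrite inE ys orbT.
by apply: finite_image; apply: finite_setX.
Qed.

End FiniteSets.

Section WordLength.
Variable W : groupType.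
Implicit Types (A : set W) (w : W) (s : seq W).

Lemma nat_minP (P : set nat) : (exists n, P n) ->
  P (nat_min P) /\ forall m, P m -> (nat_min P <= m)%N.
Proof.
move=> [n Pn]; have ex : exists n, `[< P n >] by exists n; apply/asboolP.
apply: (@xgetPex _ 0%N [set n | P n /\ forall m, P m -> (n <= m)%N]).
exists (ex_minn ex); case: ex_minnP => m /asboolP Pm minm.
by split=> // k Pk; apply: minm; apply/asboolP.
Qed.

Lemma generated_subgroup A : is_subgroup (generated A).
Proof.
split=> [H [] //|x y hx hy H sH AH|x hx H sH AH].
  by case: (sH) => _ M _; apply: M; [exact: (hx H)|exact: (hy H)].
by case: (sH) => _ _ i; apply: i; exact: (hx H).
Qed.

Lemma sub_generated A : A `<=` generated A.
Proof. by move=> x Ax H _ AH; apply: AH. Qed.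

Lemma prod_word_rev A s : (forall x, A x -> (x * x = 1)%g) ->
  (forall x, x \in s -> A x) -> ((\prod_(x <- s) x)^-1 = \prod_(x <- rev s)
    x)%g.
Proof.
move=> inv; elim: s => [|x s IH] sA; first by rewrite !big_nil invg1.
rewrite big_cons invgM rev_cons -cats1 big_cat /= big_seq1 IH.
  congr (_ * _)%g; have := inv x (sA x (mem_head _ _)).
  by move=> /(canRL (mulKg _)); rewrite mulg1.
by move=> t ts; apply: sA; rewrite inE ts orbT.
Qed.

Variable A : set W.
Hypothesis invA : forall x, A x -> (x * x = 1)%g.

Lemma generated_word w : generated A w ->
  exists2 s, (forall x, x \in s -> A x) & (w = \prod_(x <- s) x)%g.
Proof.
pose H : set W :=
  [set w | exists2 s, (forall x, x \in s -> A x) & (w = \prod_(x <- s) x)%g].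
suff sH : is_subgroup H.
  move=> /(_ H sH); apply=> x Ax; exists [:: x]; rewrite ?big_seq1 //.
  by move=> y; rewrite inE => /eqP ->.
split=> [|_ _ [s sA ->] [t tA ->]|_ [s sA ->]].
- by exists [::]; rewrite ?big_nil.
- exists (s ++ t); rewrite ?big_cat //.
  by move=> x; rewrite mem_cat => /orP[/sA|/tA].
- exists (rev s); last exact: (prod_word_rev invA sA).
  by move=> x; rewrite mem_rev => /sA.
Qed.

Lemma word_lengthP w : generated A w -> exists s,
  [/\ size s = word_length A w, (forall x, x \in s -> A x)
    & (w = \prod_(x <- s) x)%g].
Proof.
move=> /generated_word[s sA wE].
have [h _] := nat_minP (ex_intro (fun n => exists s : seq W, [/\ size s = n,
  (forall x, x \in s -> A x) & w = (\prod_(x <- s) x)%g]) (size s)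
  (ex_intro _ s (And3 erefl sA wE))).
exact: h.
Qed.

Lemma word_length_le s : (forall x, x \in s -> A x) ->
  (word_length A (\prod_(x <- s) x)%g <= size s)%N.
Proof.
move=> sA; set w := (\prod_(x <- s) x)%g.
have exs : exists s' : seq W, [/\ size s' = size s,
  (forall x, x \in s' -> A x) & w = (\prod_(x <- s') x)%g] by exists s.
have [_ h] := nat_minP (ex_intro (fun n => exists s : seq W, [/\ size s = n,
  (forall x, x \in s -> A x) & w = (\prod_(x <- s) x)%g]) (size s) exs).
exact: h exs.
Qed.

Lemma word_length1 : word_length A 1%g = 0%N.
Proof.
apply/eqP; rewrite -leqn0.
by have := @word_length_le [::]; rewrite big_nil; apply.
Qed.

Lemma word_lengthM w1 w2 : generated A w1 -> generated A w2 ->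
  (word_length A (w1 * w2)%g <= word_length A w1 + word_length A w2)%N.
Proof.
move=> /word_lengthP[s [<- sA ->]] /word_lengthP[t [<- tA ->]].
rewrite -big_cat -size_cat; apply: word_length_le => x.
by rewrite mem_cat => /orP[/sA|/tA].
Qed.

Lemma word_lengthV_le w : generated A w ->
  (word_length A w^-1%g <= word_length A w)%N.
Proof.
move=> /word_lengthP[s [<- sA ->]]; rewrite (prod_word_rev invA) // -size_rev.
by apply: word_length_le => x; rewrite mem_rev => /sA.
Qed.

Lemma word_lengthV w : generated A w -> word_length A w^-1%g = word_length A w.
Proof.
move=> gw; apply/eqP; rewrite eqn_leq word_lengthV_le //=.
rewrite -{1}[w]invgK word_lengthV_le //.
by have [_ _] := generated_subgroup A; apply.
Qed.

End WordLength.

(** * The Coxeter system, its length function and its action on [V] *)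

Section CoxeterTheory.
Variables (R : realType) (V : lmodType R) (B : {symmetric V}) (Delta : set V).
Variables (W : groupType) (r : V -> W) (act : W -> V -> V).
Hypotheses (basisD : root_basis B Delta) (coxW : coxeter_system B Delta r)
  (actW : geometric_action B Delta r act).
Implicit Types (a b u v x y z : V) (w t : W).

Local Notation pos := (PLC Delta).
Local Notation neg v := (PLC Delta (- v)).
Local Notation refl := (reflection B).
Local Notation len := (cox_length Delta r).

Lemma BC u v : B u v = B v u.
Proof. by rewrite hermC expr0 mul1r. Qed.

Lemma BDl u v x : B (u + v) x = B u x + B v x. Proof. exact: linearDl. Qed.
Lemma BDr u v x : B x (u + v) = B x u + B x v. Proof. exact: linearDr. Qed.
Lemma BNl u v : B (- u) v = - B u v. Proof. exact: linearNl. Qed.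
Lemma BNr u v : B v (- u) = - B v u. Proof. exact: linearNr. Qed.
Lemma BZl c u v : B (c *: u) v = c * B u v. Proof. exact: linearZl_LR. Qed.
Lemma BZr c u v : B v (c *: u) = c * B v u. Proof. by rewrite BC BZl BC. Qed.
Lemma B0l v : B 0 v = 0. Proof. exact: linear0l. Qed.
Lemma B0r v : B v 0 = 0. Proof. exact: linear0r. Qed.

Definition BE := (BDl, BDr, BNl, BNr, BZl, BZr, B0l, B0r).

Lemma refl_self x : B x x = 1 -> refl x x = - x.
Proof. by move=> xx; rewrite /reflection xx; vec. Qed.

Lemma reflK x v : B x x = 1 -> refl x (refl x v) = v.
Proof. by move=> xx; rewrite /reflection !BE xx; vec. Qed.

Lemma refl_form x u v : B x x = 1 -> B (refl x u) (refl x v) = B u v.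
Proof. by move=> xx; rewrite /reflection !BE xx (BC x v); ring. Qed.

Lemma reflD x u v : refl x (u + v) = refl x u + refl x v.
Proof. by rewrite /reflection !BE; vec. Qed.

Lemma reflZ x c u : refl x (c *: u) = c *: refl x u.
Proof. by rewrite /reflection !BE; vec. Qed.

Lemma reflN x u : refl x (- u) = - refl x u.
Proof. by rewrite /reflection !BE; vec. Qed.

Lemma refl_opp x u : refl (- x) u = refl x u.
Proof. by rewrite /reflection !BE; vec. Qed.

Lemma simple_norm a : Delta a -> B a a = 1.
Proof. exact: (root_basis_norm basisD). Qed.

Lemma simple_le0 a b : Delta a -> Delta b -> a <> b -> B a b <= 0.
Proof.
move=> Da Db ab; case: (root_basis_pair basisD Da Db ab) => [[m m2 ->]|];
  last lra.
rewrite oppr_le0; apply: cos_ge0_pihalf.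
have m0 : 0 < m%:R :> R by rewrite ltr0n; apply: leq_trans m2.
have pi0 := pi_gt0 R; have : 0 < pi / m%:R :> R by rewrite divr_gt0.
have : pi / m%:R <= pi / 2 :> R.
  by rewrite ler_pM2l // lef_pV2 ?ler_nat // posrE.
by move=> h1 h2; apply/andP; split => //; lra.
Qed.

Lemma sqr_eq1_pos (c : R) : 0 < c -> c * (c * 1) = 1 -> c = 1.
Proof.
move=> c0 cc; have /eqP : (c - 1) * (c + 1) = 0 by lra.
by rewrite mulf_eq0 => /orP[] /eqP; lra.
Qed.

Lemma pos_neq0 : ~ pos 0. Proof. exact: (root_basis_PLC basisD). Qed.

Lemma pos_not_neg v : pos v -> ~ neg v.
Proof. by move=> pv nv; apply: pos_neq0; rewrite -(subrr v);
  apply: PLC_add. Qed.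

(* Each simple root spans an extremal ray of the cone over Delta. *)
Lemma simple_extremal a x y l : Delta a -> pos x -> pos y -> x + y = l *: a ->
  exists2 c, 0 < c & x = c *: a.
Proof.
move=> Da px py e.
have [c [x' [c0 x'c xE hx]]] := PLC_split Da px.
have [d [y' [d0 y'c yE hy]]] := PLC_split Da py.
have x'y' : x' + y' = (l - c - d) *: a.
  have -> : x' + y' = (x + y) - (c + d) *: a by rewrite xE yE; vec.
  by rewrite e; vec.
(* Pairing with [a] makes [l - c - d] nonpositive, so an [x'] in [PLC] would give the forbidden
   relation [0 = x' + y' + (c + d - l) a]. *)
have le0 z : cone (Delta `\ a) z -> B z a <= 0.
  case=> [->|]; first by rewrite B0l.
  elim/PLC_ind => [k b k0 [Db /= ba]|u v hu hv]; last by rewrite BDl; lra.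
  by rewrite BZl pmulr_rle0 //; apply: simple_le0.
have := le0 _ (cone_add x'c y'c); rewrite x'y' BZl simple_norm // mulr1 => lcd.
have sub : Delta `\ a `<=` Delta by move=> ? [].
case: x'c => [x'0|x'P].
  case: hx => [c1|x'P]; first by exists c; rewrite // xE x'0 addr0.
  by case: pos_neq0; move: (PLC_sub sub x'P); rewrite x'0.
case: pos_neq0; move: (PLC_sub sub x'P) => {}x'P.
have : PLC Delta (x' + y').
  by apply: PLC_cone_add => //; case: y'c => [->|/(PLC_sub sub)]; [left|right].
rewrite x'y' => h; move: lcd; rewrite le_eqVlt => /orP[/eqP e0|l0].
  by move: h; rewrite e0 scale0r.
rewrite (_ : 0 = (l - c - d) *: a + (- (l - c - d)) *: a); last by vec.
by apply: PLC_add => //; apply: PLC_scale; [lra|exact: PLC_mem].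
Qed.

Lemma gen_all w : generated (simple_refls Delta r) w.
Proof. by rewrite (coxeter_system_gen coxW). Qed.

Lemma simple_invol a : Delta a -> (r a * r a = 1)%g.
Proof. by case: (coxeter_system_rel coxW) => h _; apply: h. Qed.

Lemma simple_refls_invol t : simple_refls Delta r t -> (t * t = 1)%g.
Proof. by move=> [a Da <-]; apply: simple_invol. Qed.

Lemma simpleV a : Delta a -> ((r a)^-1 = r a)%g.
Proof. by move=> /simple_invol/(canRL (mulKg _)); rewrite mulg1. Qed.

Lemma simpleK a w : Delta a -> (w * r a * r a = w)%g.
Proof. by move=> Da; rewrite -mulgA simple_invol // mulg1. Qed.

Lemma simpleKl a w : Delta a -> (r a * (r a * w) = w)%g.
Proof. by move=> Da; rewrite mulgA simple_invol // mul1g. Qed.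

Lemma W_ind (P : W -> Prop) : P 1%g ->
  (forall a w, Delta a -> P w -> P (r a * w)%g) -> forall w, P w.
Proof.
move=> P1 PS w; have [s sA ->] := generated_word simple_refls_invol (gen_all w).
elim: s sA => [|x s IH] sA; first by rewrite big_nil.
rewrite big_cons; have [a Da <-] := sA x (mem_head _ _).
by apply: PS => //; apply: IH => t ts; apply: sA; rewrite inE ts orbT.
Qed.

Lemma act1 v : act 1%g v = v. Proof. exact: (geometric_action1 actW). Qed.
Lemma actM w1 w2 v : act (w1 * w2)%g v = act w1 (act w2 v).
Proof. exact: (geometric_actionM actW). Qed.
Lemma act_r a v : Delta a -> act (r a) v = refl a v.
Proof. exact: (geometric_action_simple actW). Qed.

Lemma actK w v : act w^-1%g (act w v) = v. Proof. by rewrite -actM mulVg act1.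
  Qed.
Lemma actVK w v : act w (act w^-1%g v) = v. Proof. by rewrite -actM mulgV act1.
  Qed.

Lemma act_inj w : injective (act w).
Proof. by move=> u v e; rewrite -(actK w u) e actK. Qed.

Lemma actD w u v : act w (u + v) = act w u + act w v.
Proof.
elim/W_ind: w u v => [|a w Da IH] u v; first by rewrite !act1.
by rewrite !actM IH !act_r // reflD.
Qed.

Lemma actZ w c v : act w (c *: v) = c *: act w v.
Proof.
elim/W_ind: w v => [|a w Da IH] v; first by rewrite !act1.
by rewrite !actM IH !act_r // reflZ.
Qed.

Lemma actN w v : act w (- v) = - act w v.
Proof. by rewrite -scaleN1r actZ scaleN1r. Qed.

Lemma act0 w : act w 0 = 0.
Proof. by rewrite -(scale0r (0 : V)) actZ !scale0r. Qed.

Definition actE := (actD, actN, actZ, act0).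

Lemma act_form w u v : B (act w u) (act w v) = B u v.
Proof.
elim/W_ind: w u v => [|a w Da IH] u v; first by rewrite !act1.
by rewrite !actM !act_r // refl_form ?IH // simple_norm.
Qed.

Lemma act_refl w x v : act w (refl x v) = refl (act w x) (act w v).
Proof. by rewrite /reflection !actE act_form. Qed.

Lemma len1 : len 1%g = 0%N. Proof. exact: word_length1. Qed.

Lemma lenM w1 w2 : (len (w1 * w2)%g <= len w1 + len w2)%N.
Proof. by apply: (word_lengthM simple_refls_invol); apply: gen_all. Qed.

Lemma lenV w : len w^-1%g = len w.
Proof. by apply: (word_lengthV simple_refls_invol); apply: gen_all. Qed.

Lemma len_simple_le a : Delta a -> (len (r a) <= 1)%N.
Proof.
move=> Da; have := @word_length_le W (simple_refls Delta r) [:: r a].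
by rewrite big_seq1; apply=> x; rewrite inE => /eqP ->; exists a.
Qed.

Lemma lenrM a w : Delta a -> (len (r a * w)%g <= (len w).+1)%N.
Proof.
move=> Da; apply: leq_trans (lenM _ _) _; rewrite -add1n leq_add2r.
exact: len_simple_le.
Qed.

(** The universal property, applied to the constant map onto a transposition, provides the sign
    character. *)
Lemma len_odd a w : Delta a -> odd (len (w * r a)%g) = ~~ odd (len w).
Proof.
pose f (_ : V) : {perm bool} := tperm true false.
have ff : cox_relations B Delta f.
  have e (a' b' : V) : (f a' * f b' = 1)%g by rewrite /f tperm2.
  by split=> // a' b' _ _ _; rewrite e expg1n.
have [phi phi_r] := coxeter_system_univ coxW ff.
have phi1 : phi 1%g = 1%g.
  by apply: (mulgI (phi 1%g)); rewrite -gmulfM mulg1 mulg1.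
have h (t : W) : odd (len t) = odd_perm (phi t).
  have [s [sz sS uE]] := word_lengthP simple_refls_invol (gen_all t).
  rewrite /cox_length -sz uE; elim: s {sz uE} sS => [|x s IH] sS.
    by rewrite big_nil phi1 odd_perm1.
  have [b Db e] := sS x (mem_head _ _).
  rewrite big_cons gmulfM -e phi_r // odd_permM odd_tperm /= -IH //.
  by move=> y ys; apply: sS; rewrite inE ys orbT.
by move=> Da; rewrite !h gmulfM phi_r // odd_permM odd_tperm addbT.
Qed.

Lemma len_rM a w : Delta a ->
  len (w * r a)%g = (len w).+1 \/ len w = (len (w * r a)%g).+1.
Proof.
move=> Da; have h1 := lenM w (r a); have h2 := lenM (w * r a)%g (r a).
have h3 := len_simple_le Da; have := len_odd w Da; rewrite simpleK // in h2.
lia.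
Qed.

Lemma len_last w : w <> 1%g -> exists2 a, Delta a & (len (w * r a)%g < len w)%N.
Proof.
move=> w1; have [s [sz sS wE]] := word_lengthP simple_refls_invol (gen_all w).
case/lastP: s => [|s x] in sz sS wE; first by rewrite big_nil in wE.
have [|a Da ax] := sS x; first by rewrite mem_rcons mem_head.
exists a => //; rewrite [X in (_ < X)%N](_ : _ = (size s).+1); last first.
  by rewrite -(size_rcons s x) sz.
rewrite ltnS wE -cats1 big_cat /= big_seq1 -ax simpleK //.
by apply: word_length_le => y ys; apply: sS; rewrite mem_rcons inE ys orbT.
Qed.

(** * Positive and negative roots *)

(* The rightmost factor is r b, for every k > 0. *)
Fixpoint alt a b k : W :=
  if k is k'.+1 then (r (if odd k' then a else b) * alt a b k')%g else 1%g.

Lemma alt_pow a b k :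
  alt a b k = ((if odd k then r b else 1) * (r a * r b) ^+ k./2)%g.
Proof.
elim: k => [|k IH]; first by rewrite mul1g.
rewrite [alt _ _ _]/= IH [odd _]/= [_.+1./2]/= uphalf_half.
rewrite oddS; case: (odd k); rewrite /= ?mul1g ?add0n //.
by rewrite add1n expgS !mulgA.
Qed.

Lemma len_simple2_pow a b n : Delta a -> Delta b ->
  (len ((r a * r b) ^+ n)%g <= n.*2)%N.
Proof.
move=> Da Db; elim: n => [|n IH]; first by rewrite len1.
rewrite expgS doubleS; apply: leq_trans (lenM _ _) _.
apply: leq_trans (leq_add (lenM _ _) IH) _.
by have := len_simple_le Da; have := len_simple_le Db; lia.
Qed.

Lemma len_alt a b k : Delta a -> Delta b -> (len (alt a b k) <= k)%N.
Proof.
move=> Da Db; elim: k => [|k IH] /=; first by rewrite len1.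
apply: leq_trans (lenM _ _) _; rewrite -add1n leq_add //.
by case: (odd k); apply: len_simple_le.
Qed.

(** The relation turns the alternating word of length [m] ending in [r b] into the one ending in
    [r a], whose last letter then cancels. *)
Lemma alt_braid a b m : Delta a -> Delta b -> (0 < m)%N ->
  ((r a * r b) ^+ m = 1)%g -> (len (alt a b m * r a)%g < m)%N.
Proof.
move=> Da Db m0 ab1.
have abV : ((r a * r b)^-1 = r b * r a)%g by rewrite invgM !simpleV.
have ba1 : ((r b * r a) ^+ m = 1)%g by rewrite -abV expVgn ab1 invg1.
have shift j : (r b * (r a * r b) ^+ j * r a = (r b * r a) ^+ j.+1)%g.
  elim: j => [|j IH]; first by rewrite mulg1 expg1.
  by rewrite expgS [RHS]expgS -IH !mulgA.
rewrite alt_pow; have := odd_double_half m.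
set j := m./2; case: (odd m) => /= mE.
  rewrite shift.
  have -> : ((r b * r a) ^+ j.+1 = ((r b * r a) ^+ j)^-1)%g.
    apply: (mulIg ((r b * r a) ^+ j)%g); rewrite mulVg -expgnDr.
    by rewrite (_ : j.+1 + j = m)%N //; lia.
  by rewrite lenV; apply: leq_ltn_trans (len_simple2_pow j Db Da) _; lia.
rewrite mul1g.
have -> : ((r a * r b) ^+ j = (r b * r a) ^+ j)%g.
  rewrite -abV expVgn; apply: (mulIg ((r a * r b) ^+ j)%g).
  by rewrite mulVg -expgnDr (_ : j + j = m)%N //; lia.
case: j mE => [|j] mE; first by lia.
rewrite expgSr -!mulgA simple_invol // mulg1; apply: leq_ltn_trans (lenM _ _) _.
apply: leq_ltn_trans (leq_add (len_simple2_pow j Db Da) (len_simple_le Db)) _.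
by lia.
Qed.

Lemma alt_add a b m k : Delta a -> Delta b -> exists2 t, (len t <= k)%N &
  alt a b (k + m) = (t * alt a b m)%g.
Proof.
move=> Da Db; elim: k => [|k [t lt e]]; first by exists 1%g;
  rewrite ?len1 ?mul1g.
rewrite addSn /= e mulgA; eexists; last by reflexivity.
apply: leq_trans (lenM _ _) _; rewrite -add1n leq_add //.
by case: (odd _); apply: len_simple_le.
Qed.

Lemma act_alt a b k (c := - B a b) : Delta a -> Delta b ->
  act (alt a b k) a = if odd k then cheb c k *: a + cheb c k.+1 *: b
                      else cheb c k.+1 *: a + cheb c k *: b.
Proof.
move=> Da Db; elim: k => [|k IH]; first by rewrite act1 /=; vec.
rewrite [alt _ _ _]/= actM IH [odd _.+1]/=.
case: (odd k); rewrite act_r // chebSS /reflection !BE ?(BC b a).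
  by rewrite (simple_norm Da) /negb /c; vec.
by rewrite (simple_norm Db) /negb /c; vec.
Qed.

Lemma cone_pos v : cone Delta v -> v <> 0 -> pos v.
Proof. by case. Qed.

Lemma cox_exponentP a b : Delta a -> Delta b -> a <> b ->
  (exists m, [/\ (2 <= m)%N, B a b = - cos (pi / m%:R) & ((r a * r b) ^+ m =
    1)%g])
  \/ B a b <= -1.
Proof.
move=> Da Db ab; case: (root_basis_pair basisD Da Db ab) => [[m m2 h]|];
  last by right.
left; exists (cox_exponent B a b).
have [m2' h'] : [set m | (2 <= m)%N /\ B a b = - cos (pi / m%:R)] (cox_exponent
  B a b).
  by apply: xgetPex; exists m.
by split=> //; case: (coxeter_system_rel coxW) => _; apply.
Qed.

(** Induction on the length. With [b] a right descent of [w], write [w = u * alt a b k] with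
    additive lengths and [k] maximal. Neither [r a] nor [r b] shortens [u] from the right, so
    [act u a] and [act u b] are positive, and [act w a] combines them with Chebyshev coefficients.
    These are nonnegative because [k] is less than the exponent [m] when that is finite: otherwise
    the braid relation would make [w * r a] shorter than [w]. *)
Theorem pos_of_len w a : Delta a -> (len w < len (w * r a)%g)%N -> pos (act w
  a).
Proof.
have [n] := ubnP (len w); elim: n w a => // n IH w a /ltnSE wn Da wa.
have [->|w1] := pselect (w = 1%g); first by rewrite act1; apply: PLC_mem.
have [b Db wb] := len_last w1.
have ab : a <> b by move=> e; move: wb; rewrite -e; lia.
pose P k := `[< exists2 u : W, w = (u * alt a b k)%g & len w = (len u + k)%N >].
have exP : exists k, P k.
  by exists 0%N; apply/asboolP; exists w; rewrite ?mulg1 ?addn0.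
have P1 : P 1%N.
  apply/asboolP; exists (w * r b)%g; first by rewrite /= mulg1 simpleK.
  by have := len_rM w Db; lia.
have ubP k : P k -> (k <= len w)%N by move=> /asboolP[u _ ->]; apply: leq_addl.
case: (ex_maxnP exP ubP) => k /asboolP[u wE lw] maxk.
have k0 : (0 < k)%N by apply: maxk.
have [ua ub] : (len u < len (u * r a)%g)%N /\ (len u < len (u * r b)%g)%N.
  (* [c k] is the letter that would extend [alt a b k] on the left, so it is handled by maximality;
     [c k.-1] is its leftmost letter, and a cancellation there would contradict the length of
     [w]. *)
  pose c i := if odd i then a else b.
  have Dc i : Delta (c i) by rewrite /c; case: odd.
  suff [h1 h2] : (len u < len (u * r (c k))%g)%N /\ (len u < len (u * r (c
    k.-1))%g)%N.
    by move: h1 h2; rewrite /c; case: (k) k0 => //= k' _; case: (odd k').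
  split.
    have [-> //|lu] := len_rM u (Dc k).
    suff /maxk : P k.+1 by rewrite ltnn.
    apply/asboolP; exists (u * r (c k))%g; last by lia.
    by rewrite /= -/(c k) mulgA simpleK.
  have [-> //|lu] := len_rM u (Dc k.-1).
  have := lenM (u * r (c k.-1))%g (alt a b k.-1).
  rewrite (_ : _ * alt a b _ = w)%g; last first.
    by rewrite wE; case: (k) k0 => //= k' _; rewrite !mulgA.
  by have := len_alt k.-1 Da Db; lia.
have up : pos (act u a) by apply: IH => //; lia.
have up' : pos (act u b) by apply: IH => //; lia.
apply: cone_pos; last first.
  move=> e; have := simple_norm Da; rewrite -(act_form w) e B0l; lra.
suff [c1 c2] : 0 <= cheb (- B a b) k /\ 0 <= cheb (- B a b) k.+1.
  rewrite wE actM act_alt //; case: odd; rewrite !actE;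
  by apply: cone_add; apply: cone_scale => //; right.
have [[m [m2 Bab braid]]|Bab] := cox_exponentP Da Db ab; last first.
  by split; apply: cheb_ge0; lra.
rewrite Bab opprK.
suff km : (k < m)%N by split; apply: cheb_sin => //; apply: ltnW.
rewrite ltnNge; apply/negP => mk.
have [t lt] := alt_add m (k - m) Da Db; rewrite subnK // => altE.
have := alt_braid Da Db (ltnW m2) braid.
have := lenM (u * t)%g (alt a b m * r a)%g; have := lenM u t.
have -> : (u * t * (alt a b m * r a) = w * r a)%g by rewrite wE altE !mulgA.
by lia.
Qed.

Local Notation Phi := (Defs.roots Delta act).
Local Notation PhiP := (pos_roots Delta act).
Local Notation T := (refls Delta r).
Local Notation rr := (refl_of_root B Delta r act).

Lemma simple_root a : Delta a -> Phi a.
Proof. by move=> Da; exists 1%g, a; rewrite act1. Qed.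

Lemma simple_PhiP a : Delta a -> PhiP a.
Proof. by move=> Da; split; [apply: simple_root|apply: PLC_mem]. Qed.

Lemma root_act w x : Phi x -> Phi (act w x).
Proof. by move=> [u [a [Da ->]]]; exists (w * u)%g, a; rewrite actM. Qed.

Lemma root_norm x : Phi x -> B x x = 1.
Proof. by move=> [u [a [Da ->]]]; rewrite act_form simple_norm. Qed.

Lemma root_opp x : Phi x -> Phi (- x).
Proof.
move=> [u [a [Da ->]]]; exists (u * r a)%g, a; split=> //.
by rewrite actM act_r // refl_self ?simple_norm // actN.
Qed.

Lemma root_pos_neg x : Phi x -> pos x \/ neg x.
Proof.
move=> [w [a [Da ->]]]; have [h|h] := len_rM w Da.
  by left; apply: pos_of_len => //; rewrite h.
right; rewrite (_ : - _ = act (w * r a)%g a).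
  by apply: pos_of_len => //; rewrite simpleK // h.
by rewrite actM act_r // refl_self ?simple_norm // actN.
Qed.

Lemma root_not_neg x : Phi x -> ~ neg x -> pos x.
Proof. by move=> /root_pos_neg[]. Qed.

Lemma root_not_pos x : Phi x -> ~ pos x -> neg x.
Proof. by move=> /root_pos_neg[]. Qed.

(** Were [refl a x] negative, [x] and [- refl a x] would be positive with sum a multiple of [a];
    extremality puts [x] on the ray of [a], and norm 1 forces equality. *)
Lemma simple_perm a x : Delta a -> Phi x -> pos x -> x <> a -> pos (refl a x).
Proof.
move=> Da rx px xa; apply: root_not_neg => [|nx].
  by rewrite -act_r //; apply: root_act.
have [|c c0 xE] := simple_extremal (l := 2 * B x a) Da px nx.
  by rewrite /reflection; vec.
apply: xa; have := root_norm rx; rewrite xE !BE simple_norm // => c1.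
by rewrite (sqr_eq1_pos c0 c1) scale1r.
Qed.

Lemma act_pos_eq1 w : (forall a, Delta a -> pos (act w a)) -> w = 1%g.
Proof.
move=> h; apply: contrapT => /len_last[a Da wa].
have /pos_of_len-/(_ Da) : (len (w * r a)%g < len (w * r a * r a)%g)%N.
  by rewrite simpleK.
rewrite actM act_r // refl_self ?simple_norm // actN.
by apply: pos_not_neg; apply: h.
Qed.

Lemma act_faithful w1 w2 : (forall v, act w1 v = act w2 v) -> w1 = w2.
Proof.
move=> h; apply: (mulgI w2^-1%g); rewrite mulVg; apply: act_pos_eq1 => a Da.
by rewrite actM h actK; apply: PLC_mem.
Qed.

Lemma rrP x : Phi x -> T (rr x) /\ forall v, act (rr x) v = refl x v.
Proof.
move=> [w [a [Da ->]]].
apply: (@xgetPex _ 1%g [set t | T t /\ forall v, act t v = refl (act w a) v]).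
exists (w * r a * w^-1)%g; split; first by exists w, (r a); split=> //;
  exists a.
by move=> v; rewrite !actM act_r // act_refl actVK.
Qed.

Lemma act_rr x v : Phi x -> act (rr x) v = refl x v.
Proof. by move=> /rrP[_]. Qed.

Lemma rr_refl x : Phi x -> T (rr x).
Proof. by move=> /rrP[]. Qed.

Lemma rr_act w x : Phi x -> rr (act w x) = (w * rr x * w^-1)%g.
Proof.
move=> rx; apply: act_faithful => v; rewrite act_rr; last exact: root_act.
by rewrite !actM act_rr // act_refl actVK.
Qed.

Lemma rr_simple a : Delta a -> rr a = r a.
Proof.
move=> Da; apply: act_faithful => v; rewrite act_rr; last exact: simple_root.
by rewrite act_r.
Qed.

Lemma rr_opp x : Phi x -> rr (- x) = rr x.
Proof.
move=> rx; apply: act_faithful => v; rewrite !act_rr ?refl_opp //.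
exact: root_opp.
Qed.

Lemma rrK x : Phi x -> (rr x * rr x = 1)%g.
Proof.
move=> rx; apply: act_faithful => v.
by rewrite actM act1 !act_rr // reflK // root_norm.
Qed.

Lemma rrV x : Phi x -> ((rr x)^-1 = rr x)%g.
Proof. by move=> /rrK/(canRL (mulKg _)); rewrite mulg1. Qed.

Lemma root_parallel x y c : PhiP x -> PhiP y -> x = c *: y -> x = y.
Proof.
move=> [rx px] [ry py] e; have := root_norm rx;
  rewrite e !BE root_norm // => cc.
have [c0|c0] := ltP 0 c; first by rewrite (sqr_eq1_pos c0 cc) scale1r.
have c1 : c = -1.
  apply/eqP; rewrite -eqr_oppLR; apply/eqP/sqr_eq1_pos; last by lra.
  by rewrite lt_neqAle oppr_ge0 c0 andbT; apply/eqP => c1; move: cc;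
    rewrite -[c]opprK -c1; lra.
by case: (pos_not_neg py); rewrite -[- y]scaleN1r -c1 -e.
Qed.

Lemma rr_inj x y : PhiP x -> PhiP y -> rr x = rr y -> x = y.
Proof.
move=> px py e; have [rx _] := px; have [ry _] := py.
apply: (root_parallel (c := B x y)) px py _.
have := act_rr x rx; rewrite e act_rr // refl_self ?root_norm // /reflection =>
  h.
have h2 : (2 * B x y) *: y = x + x by rewrite -[X in _ + X]opprK -h; vec.
by apply: (@scalerI _ _ 2) => //; rewrite scalerA h2; vec.
Qed.

Lemma reflsP t : T t -> exists2 x, PhiP x & rr x = t.
Proof.
move=> [w [_ [[a Da <-] ->]]].
have rx : Phi (act w a) by apply: root_act; apply: simple_root.
have e : rr (act w a) = (w * r a * w^-1)%g.
  by rewrite rr_act ?rr_simple //; apply: simple_root.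
have [px|nx] := root_pos_neg rx; first by exists (act w a).
by exists (- act w a); [split=> //; apply: root_opp|rewrite rr_opp].
Qed.

Local Notation alpha := (root_of_refl B Delta r act).

Lemma root_of_reflP t : T t -> PhiP (alpha t) /\ rr (alpha t) = t.
Proof.
by move=> /reflsP[x px e]; apply: (@xgetPex _ 0 [set x | PhiP x /\ rr x = t]);
  exists x.
Qed.

Lemma root_of_refl_rr x : PhiP x -> alpha (rr x) = x.
Proof.
move=> px; have [h1 h2] := root_of_reflP (rr_refl px.1).
exact: rr_inj.
Qed.

(** The strong exchange condition. Read from the right, the word makes [x] negative at a letter
    whose simple root is the current image of [x], and multiplying by [rr x] deletes that letter. *)
Lemma len_refl_word s x : (forall a, a \in s -> Delta a) -> PhiP x ->
  neg (act (\prod_(a <- s) r a)%g x) ->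
  (len (\prod_(a <- s) r a * rr x)%g < size s)%N.
Proof.
move=> + [rx px]; elim: s => [|a s IH] sD.
  by rewrite big_nil act1 => /(pos_not_neg px).
have Da := sD a (mem_head _ _).
have {}IH := IH (fun b bs => sD b (mem_behead (s := a :: s) bs)).
rewrite big_cons; set w := (\prod_(a <- s) r a)%g in IH *.
have [/IH lw _|nw] := pselect (neg (act w x)).
  by rewrite -mulgA ltnS; apply: leq_trans (lenrM _ Da) _.
have rwx := root_act w rx; have pw := root_not_neg rwx nw.
have [wa _|wa] := pselect (act w x = a); last first.
  by rewrite actM act_r // => /(pos_not_neg (simple_perm Da rwx pw wa)).
have := rr_act w rx; rewrite wa rr_simple // => e.
rewrite -mulgA (_ : w * rr x = r a * w)%g; last by rewrite e mulgVK.
rewrite simpleKl //= ltnS.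
have -> : w = (\prod_(t <- map r s) t)%g by rewrite big_map.
rewrite -(size_map r s); apply: word_length_le => t /mapP[b bs ->].
by exists b => //; apply: sD; rewrite inE bs orbT.
Qed.

Lemma simple_word w : exists s, [/\ size s = len w,
  (forall a, a \in s -> Delta a) & (w = \prod_(a <- s) r a)%g].
Proof.
have [s [sz sS wE]] := word_lengthP simple_refls_invol (gen_all w).
rewrite -/len in sz; rewrite -sz wE {sz wE}.
elim: s sS => [|t s IH] sS; first by exists [::]; rewrite !big_nil.
have [a Da <-] := sS t (mem_head _ _).
have [|s' [sz s'D e]] := IH; first by move=> b bs; apply: sS;
  rewrite inE bs orbT.
exists (a :: s'); rewrite !big_cons /= sz e; split=> // b.
by rewrite inE => /orP[/eqP ->|/s'D].
Qed.

Lemma neg_len w x : PhiP x -> neg (act w x) <-> (len (w * rr x)%g < len w)%N.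
Proof.
have h (u : W) y : PhiP y -> neg (act u y) -> (len (u * rr y)%g < len u)%N.
  have [s [<- sD ->]] := simple_word u; exact: len_refl_word.
move=> px; have [rx _] := px; split; first exact: h.
move=> lt; apply: root_not_pos; first exact: root_act.
move=> pw; have := h (w * rr x)%g x px.
rewrite -mulgA rrK // mulg1 actM act_rr // refl_self ?root_norm //.
by rewrite actN opprK => /(_ pw); lia.
Qed.

(** The inversion set at the level of roots: by [neg_len], [rr] maps it onto [Nbar w]. *)
Definition Nset w : set V := [set x | PhiP x /\ neg (act w x)].

Lemma Nset_finite w : finite_set (Nset w).
Proof.
elim/W_ind: w => [|a w Da IH].
  apply: (sub_finite_set (B := set0)) => // x [[_ px]].
  by rewrite act1 => /(pos_not_neg px).
apply: (sub_finite_set (B := Nset w `|` [set act w^-1%g a])); last first.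
  by rewrite finite_setU; split=> //; apply: finite_set1.
move=> x [[rx px]]; rewrite actM act_r // => nx.
have [|nw] := pselect (neg (act w x)); first by left.
right; apply: (act_inj (w := w)); rewrite actVK; apply: contrapT => wa.
case: (pos_not_neg (simple_perm Da _ (root_not_neg _ nw) wa)) => //;
  exact: root_act.
Qed.

Lemma rot_expV x y n : Phi x -> Phi y ->
  ((rr y * rr x) ^+ n = ((rr x * rr y) ^+ n)^-1)%g.
Proof. by move=> rx ry; rewrite -expVgn invgM !rrV. Qed.

(** * Dominance *)

(** For roots with [B u v = k], each new term is minus the reflection of the term before last in the
    last one, so the sequence runs through roots of a dihedral subsystem. *)
Fixpoint rec2 (k : R) u v n : V :=
  match n with
  | 0 => u
  | n1.+1 => match n1 with 0 => v | n2.+1 => (2 * k) *: rec2 k u v n1 - rec2 k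
    u v n2 end
  end.

Lemma rec2SS k u v n : rec2 k u v n.+2 = (2 * k) *: rec2 k u v n.+1 - rec2 k u
  v n.
Proof. by []. Qed.

Lemma rec2E k u v n : rec2 k u v n.+1 = cheb k n.+1 *: v - cheb k n *: u.
Proof.
suff [] : rec2 k u v n.+1 = cheb k n.+1 *: v - cheb k n *: u /\
  rec2 k u v n.+2 = cheb k n.+2 *: v - cheb k n.+1 *: u by [].
elim: n => [|n [IH1 IH2]]; first by split; rewrite /=; vec.
by split=> //; rewrite rec2SS IH2 IH1 !chebSS; vec.
Qed.

Lemma rec2_root k u v n : Phi u -> Phi v -> B u v = k -> Phi (rec2 k u v n).
Proof.
move=> ru rv uv; suff [] : [/\ Phi (rec2 k u v n), Phi (rec2 k u v n.+1) &
  B (rec2 k u v n) (rec2 k u v n.+1) = k] by [].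
elim: n => // n [r1 r2 e].
have -> : rec2 k u v n.+2 = - act (rr (rec2 k u v n.+1)) (rec2 k u v n).
  by rewrite act_rr // rec2SS /reflection e; vec.
split=> //; first by apply/root_opp/root_act.
by rewrite act_rr // /reflection !BE root_norm // (BC _ (rec2 k u v n)) e; ring.
Qed.

(** At a sign change of the Chebyshev values, [v (n+2)] is a combination of [v 0] and [v 1] with
    nonpositive coefficients. *)
Lemma not_all_pos k (v : nat -> V) : k < 1 ->
  (forall n, v n.+2 = (2 * k) *: v n.+1 - v n) -> ~ forall n, pos (v n).
Proof.
move=> k1 vSS pv; have [n c1 c2] := cheb_sign_change k1.
have vE m : v m = rec2 k (v 0%N) (v 1%N) m.
  elim/ltn_ind: m => -[|[|m]] // IH; rewrite rec2SS -!IH //; exact: vSS.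
apply: pos_neq0; rewrite (_ : 0 = v n.+2 + (- cheb k n.+2 *: v 1%N + cheb k
  n.+1 *: v 0%N)).
  apply: PLC_cone_add => //; apply: cone_add; apply: cone_scale;
    rewrite ?oppr_ge0 //.
  - exact/cone_PLC/pv.
  - exact: ltW.
  - exact/cone_PLC/pv.
by rewrite vE rec2E; vec.
Qed.

(* The dominance order of Brink and Howlett. *)
Definition dom x y := forall w, neg (act w x) -> neg (act w y).

Lemma dom_trans y x z : dom x y -> dom y z -> dom x z.
Proof. by move=> xy yz w /xy/yz. Qed.

Lemma dom_act w x y : dom x y -> dom (act w x) (act w y).
Proof. by move=> xy u; rewrite -!actM; apply: xy. Qed.

Lemma dom_opp x y : Phi x -> Phi y -> dom x y -> dom (- y) (- x).
Proof.
move=> rx ry xy w; rewrite !actN !opprK => py.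
apply: contrapT => px; have := xy w (root_not_pos (root_act w rx) px).
exact: pos_not_neg.
Qed.

(** Dominance moves along the sequence: if [a] dominates [b], then [rr a], which negates [a], shows
    that [- refl a b] is positive, and transporting the relation by [rr a] and changing signs shows
    that [- refl a b] dominates [a]. *)
Lemma dom_rec2_pos x y n : PhiP x -> PhiP y -> dom x y -> pos (rec2 (B x y) y x
  n).
Proof.
move=> [rx px] [ry py] xy.
have rz m : Phi (rec2 (B x y) y x m) by apply: rec2_root; rewrite // BC.
suff [] : [/\ pos (rec2 (B x y) y x n), pos (rec2 (B x y) y x n.+1),
  B (rec2 (B x y) y x n.+1) (rec2 (B x y) y x n) = B x y &
  dom (rec2 (B x y) y x n.+1) (rec2 (B x y) y x n)] by [].
elim: n => // n; have := rz n; have := rz n.+1; rewrite rec2SS.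
move: (rec2 _ _ _ n.+1) (rec2 _ _ _ n) => a b ra rb [pb pa <- ab].
have e : (2 * B a b) *: a - b = - refl a b by rewrite BC /reflection; vec.
rewrite e; split=> //.
- have := ab (rr a); rewrite !act_rr //; apply.
  by rewrite refl_self ?root_norm // opprK.
- by rewrite -e !BE root_norm // (BC b a); ring.
- have := dom_act (w := rr a) ab; rewrite !act_rr // refl_self ?root_norm // =>
    h.
  rewrite -[a in dom _ a]opprK; apply: dom_opp => //; first exact: root_opp.
  by rewrite -act_rr //; apply: root_act.
Qed.

Lemma dom_ge1 x y : PhiP x -> PhiP y -> dom x y -> 1 <= B x y.
Proof.
move=> px py xy; rewrite leNgt; apply/negP => d1.
apply: (@not_all_pos (B x y) (rec2 (B x y) y x)) => // n.
exact: dom_rec2_pos.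
Qed.

Lemma rec2_inj x y : PhiP x -> PhiP y -> x <> y -> 1 <= B x y ->
  injective (fun n => rec2 (B x y) y x n.+1).
Proof.
move=> px py xy d1 m n; rewrite !rec2E; set d := B x y in d1 * => e.
have e' : (cheb d m.+1 - cheb d n.+1) *: x = (cheb d m - cheb d n) *: y.
  rewrite -[LHS]addr0 -[0](subrr (cheb d m *: y)).
  transitivity ((cheb d m.+1 *: x - cheb d m *: y) + cheb d m *: y - cheb d
    n.+1 *: x).
    by vec.
  by rewrite e; vec.
apply: (cheb_inj d1); apply: contrapT => mn; apply: xy.
have c0 : cheb d m.+1 - cheb d n.+1 != 0.
  by rewrite subr_eq0; apply/eqP => /(cheb_inj d1) [] emn; apply: mn;
    rewrite emn.
apply: (root_parallel (c := (cheb d m.+1 - cheb d n.+1)^-1 * (cheb d m - cheb d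
  n))) => //.
by rewrite -scalerA -e' scalerA mulVf // scale1r.
Qed.

(* The roots cheb (n+1) x - cheb n y are negated by w, hence almost all of them
   are negative, Nset w being finite. *)
Lemma recession_neg w x y : PhiP x -> PhiP y -> x <> y -> 1 <= B x y ->
  neg (act w x) -> pos (act w y) ->
  exists n, neg (cheb (B x y) n.+1 *: x - cheb (B x y) n *: y).
Proof.
move=> px py xy d1 nx wy; apply: contrapT => h.
set d := B x y in d1 h; have rz n : Phi (rec2 d y x n.+1).
  by apply: rec2_root; [exact: py.1|exact: px.1|rewrite BC].
apply: (finite_no_inj (Nset_finite w) _ (rec2_inj px py xy d1)) => n.
split; first split=> //.
  by apply: root_not_neg => // /[!rec2E] nz; apply: h; exists n.
rewrite rec2E !actE -/d.
rewrite (_ : - _ = cheb d n.+1 *: (- act w x) + cheb d n *: act w y);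
  last by vec.
apply: PLC_cone_add; first by apply: PLC_scale; rewrite // (cheb_mono (m := 0)).
by apply: cone_scale; [exact: cheb_ge0|exact: cone_PLC].
Qed.

(** If both fail, [recession_neg] makes [c (n+1) x - c n y] and [c (m+1) y - c m x] negative.
    Eliminating [y] leaves a positive multiple of [x], since [c] is strictly increasing, and hence a
    vanishing positive combination. *)
Lemma dom_total x y : PhiP x -> PhiP y -> 1 <= B x y -> dom x y \/ dom y x.
Proof.
move=> px py d1; have [->|xy] := pselect (x = y); first by left.
apply: contrapT => /not_orP[/existsNP[w /not_implyP[nx ny]] /existsNP[w'
  /not_implyP[ny' nx']]].
have [n hn] := recession_neg px py xy d1 nx (root_not_neg (root_act w py.1) ny).
have d1' : 1 <= B y x by rewrite BC.
have [m hm] := recession_neg py px (nesym xy) d1' ny'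
  (root_not_neg (root_act w' px.1) nx').
move: hm; rewrite (BC y x) => hm; set c := cheb (B x y) in hn hm.
have c0 i : 0 <= c i by apply: cheb_ge0.
have cS i : c i < c i.+1 by apply: cheb_mono.
apply: pos_neq0.
rewrite (_ : 0 = (c m.+1 *: (- (c n.+1 *: x - c n *: y)) +
   (c m.+1 * c n.+1 - c n * c m) *: x) + c n *: (- (c m.+1 *: y - c m *: x)));
     last by vec.
apply: PLC_cone_add; last by apply: cone_scale => //; right.
apply: PLC_add; apply: PLC_scale => //.
- exact: le_lt_trans (cS m).
- by rewrite subr_gt0 mulrC ltr_pM.
- by case: px.
Qed.

Lemma root_simple x : Phi x -> exists w, Delta (act w x).
Proof. by move=> [w [a [Da ->]]]; exists w^-1%g; rewrite actK. Qed.

(** Move [x] to a simple root: its reflection makes no other positive root negative. *)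
Lemma dom_antisym x y : PhiP x -> PhiP y -> dom x y -> dom y x -> x = y.
Proof.
move=> [rx px] [ry py] xy yx; have [w Da] := root_simple rx.
apply: (act_inj (w := w)); apply: contrapT => wxy.
have pw : pos (act w y).
  apply: root_not_neg => [|/yx]; first exact: root_act.
  by apply: pos_not_neg; apply: PLC_mem.
have := xy (r (act w x) * w)%g; rewrite !actM !act_r // refl_self ?simple_norm
  //.
rewrite opprK => /(_ (PLC_mem Da)); apply: pos_not_neg.
by apply: simple_perm => //; [exact: root_act|exact: nesym].
Qed.

Definition dominated x : set V := [set y | [/\ PhiP y, y <> x & dom x y]].

Lemma dominated_finite x : PhiP x -> finite_set (dominated x).
Proof.
move=> [rx px]; apply: sub_finite_set (Nset_finite (rr x)) => y [py _ xy].
by split=> //; apply: xy; rewrite act_rr // refl_self ?opprK ?root_norm.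
Qed.

(** The orbit of [y] under the rotation [g] obeys the recurrence with parameter
    [2 B x y ^+ 2 - 1 < 1] (the cosine of the double angle), so it passes from positive to negative
    beyond every index. Each such passage is at a member of the finite set [Nset g]; hence the orbit
    repeats. *)
Lemma rot_period x y : Phi x -> Phi y -> -1 < B x y < 1 ->
  exists2 p, (0 < p)%N & act ((rr x * rr y) ^+ p)%g y = y.
Proof.
move=> rx ry /andP[dm d1]; set g := (rr x * rr y)%g.
pose v n := act (g ^+ n)%g y; set k := 2 * B x y ^+ 2 - 1.
have k1 : k < 1 by rewrite /k; nra.
have gy v' : act g v' = refl x (refl y v') by rewrite actM !act_rr.
have vSS n : v n.+2 = (2 * k) *: v n.+1 - v n.
  rewrite /v !expgSr !actM -actZ -actN -actD; congr act.
  rewrite !act_rr // /reflection !BE !root_norm // (BC y x) /k; vec.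
have rv n : Phi (v n) by apply: root_act.
have flips n0 : exists2 n, (n0 <= n)%N & pos (v n) /\ neg (v n.+1).
  have shiftSS n1 n : v (n1 + n.+2)%N = (2 * k) *: v (n1 + n.+1)%N - v (n1 +
    n)%N.
    by rewrite !addnS vSS.
  have [n1 n01 pn1] : exists2 n, (n0 <= n)%N & pos (v n).
    apply: contrapT => h; apply: (@not_all_pos k (fun n => - v (n0 + n)%N)) =>
      // n.
      by rewrite shiftSS; vec.
    apply: root_not_pos => // pn; apply: h; exists (n0 + n)%N => //;
      exact: leq_addr.
  have [n2 nn2] : exists n, ~ pos (v (n1 + n)%N).
    by apply: contrapT => /forallNP h; apply: (not_all_pos k1 (shiftSS n1)) =>
      n; apply: contrapT; apply: h.
  elim: n2 nn2 => [|n2 IH] nn2; first by rewrite addn0 in nn2.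
  have [pn2|/IH //] := pselect (pos (v (n1 + n2)%N)).
  exists (n1 + n2)%N; first by apply: leq_trans n01 (leq_addr _ _).
  by split=> //; rewrite -addnS; apply: root_not_pos.
have [] := @finite_infinitely_often _ (Nset g) [set n | pos (v n) /\ neg (v
  n.+1)] v.
- exact: Nset_finite.
- by move=> n [pn]; split; [split|rewrite -actM -expgS].
- exact: flips.
move=> i [j [ij e]]; exists (j - i)%N; first by rewrite subn_gt0.
apply: (act_inj (w := (g ^+ i)%g)); rewrite -actM -expgnDr subnKC ?(ltnW ij) //.
Qed.

(** The Gram determinant [1 - B x y ^+ 2] is nonzero, so [V] is the sum of the plane and its
    orthogonal complement; [l] and [m] solve the Gram system. *)
Lemma act_fix_plane g x y : Phi x -> Phi y -> -1 < B x y < 1 ->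
  act g x = x -> act g y = y ->
  (forall v, B v x = 0 -> B v y = 0 -> act g v = v) -> g = 1%g.
Proof.
move=> rx ry /andP[dm d1] gx gy gv; apply: act_faithful => v; rewrite act1.
set d := B x y in dm d1; have d2 : 1 - d ^+ 2 != 0 by apply/eqP; nra.
pose l := (B v x - d * B v y) / (1 - d ^+ 2).
pose m := (B v y - d * B v x) / (1 - d ^+ 2).
pose p := v - l *: x - m *: y.
have vE : v = l *: x + m *: y + p by rewrite /p; vec.
have px : B p x = 0.
  by rewrite /p !BE root_norm // (BC y x) -/d /l /m; field.
have py : B p y = 0 by rewrite /p !BE root_norm // -/d /l /m; field.
transitivity (act g (l *: x + m *: y + p)); first by rewrite -vE.
by move: p vE px py => p vE px py; rewrite !actE gx gy gv // -vE.
Qed.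

Lemma act_perp_exp x y n v : Phi x -> Phi y -> B v x = 0 -> B v y = 0 ->
  act ((rr x * rr y) ^+ n)%g v = v.
Proof.
move=> rx ry vx vy; elim: n => [|n IH]; first by rewrite act1.
by rewrite expgS actM IH actM !act_rr // /reflection vy mulr0 scale0r subr0 vx
  mulr0 scale0r subr0.
Qed.

Lemma act_expM g n m v : act (g ^+ n)%g v = v -> act (g ^+ (n * m))%g v = v.
Proof.
move=> e; rewrite expgnA; elim: m => [|m IH]; first by rewrite act1.
by rewrite expgS actM IH.
Qed.

Lemma rot_finite_order x y : Phi x -> Phi y -> -1 < B x y < 1 ->
  exists2 p, (0 < p)%N & ((rr x * rr y) ^+ p = 1)%g.
Proof.
move=> rx ry d; have [p p0 py] := rot_period rx ry d.
have d' : -1 < B y x < 1 by rewrite BC.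
have [q q0 qx] := rot_period ry rx d'.
exists (p * q)%N; first by rewrite muln_gt0 p0.
apply: (act_fix_plane rx ry d); [|exact: act_expM|by move=> v;
  apply: act_perp_exp].
rewrite mulnC; apply: act_expM.
move: qx; rewrite rot_expV // => qx.
by apply: (act_inj (w := ((rr x * rr y) ^+ q)^-1%g)); rewrite actK qx.
Qed.

(** * Reflection subgroups and heights *)

Definition Psi (H : set W) x := PhiP x /\ H (rr x).

(** A length-free description of [canonical_roots], justified by [canonical_rootsE]. *)
Definition canon H g := Psi H g /\ forall z, Psi H z -> z <> g -> pos (refl g
  z).

Lemma rr_reflE g z : Phi g -> Phi z -> rr (refl g z) = (rr g * rr z * rr g)%g.
Proof. by move=> rg rz; rewrite -act_rr // rr_act // rrV. Qed.

Lemma root_refl g z : Phi g -> Phi z -> Phi (refl g z).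
Proof. by move=> rg rz; rewrite -act_rr //; apply: root_act. Qed.

Lemma Psi_refl H g z : is_subgroup H -> Psi H g -> Psi H z -> pos (refl g z) ->
  Psi H (refl g z).
Proof.
move=> [_ HM _] [[rg _] Hg] [[rz _] Hz] p; split; first by split=> //;
  apply: root_refl.
by rewrite rr_reflE //; apply: (HM) => //; apply: (HM).
Qed.

Lemma Psi_refl_opp H g z : is_subgroup H -> Psi H g -> Psi H z -> neg (refl g
  z) ->
  Psi H (- refl g z).
Proof.
move=> [_ HM _] [[rg _] Hg] [[rz _] Hz] p; have rgz := root_refl rg rz.
split; first by split=> //; apply: root_opp.
by rewrite rr_opp // rr_reflE //; apply: (HM) => //; apply: (HM).
Qed.

Lemma Psi_act H w z : is_subgroup H -> H w -> Psi H z ->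
  Psi H (act w z) \/ Psi H (- act w z).
Proof.
move=> [_ HM HV] Hw [[rz _] Hz]; have rwz := root_act w rz.
have Hwz : H (rr (act w z)).
  by rewrite rr_act //; apply: (HM); [apply: (HM)|apply: (HV)].
have [p|n] := root_pos_neg rwz; [left|right]; split=> //.
- by split=> //; apply: root_opp.
- by rewrite rr_opp.
Qed.

Lemma neg_refl_self x : PhiP x -> neg (refl x x).
Proof. by move=> [rx px]; rewrite refl_self ?opprK ?root_norm. Qed.

Lemma canonical_rootsE H g : canonical_roots B Delta r act H g <-> canon H g.
Proof.
split.
- move=> [pg [Tg e]].
  have Hg : H (rr g) by have : [set rr g] (rr g) by []; rewrite -e => -[].
  split=> // z [pz Hz] zg; apply: root_not_neg; first by apply: root_refl;
    [case: pg|case: pz].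
  move=> nz; apply: zg; apply: rr_inj => //.
  have : (Nbar Delta r (rr g) `&` H) (rr z).
    split=> //; split; first by apply: rr_refl; case: pz.
    by apply/neg_len => //; rewrite act_rr //; case: pg.
  by rewrite e.
- move=> [[pg Hg] h]; split=> //; split; first by apply: rr_refl; case: pg.
  apply/seteqP; split=> [t [[/reflsP[z pz <-] lz] Hz]|_ ->].
    congr rr; apply: contrapT => zg; apply: (pos_not_neg (h z (conj pz Hz) zg)).
    by rewrite -act_rr; [apply/neg_len|case: pg].
  split=> //; split; first by apply: rr_refl; case: pg.
  apply/neg_len => //; rewrite act_rr; last by case: pg.
  exact: neg_refl_self.
Qed.

Lemma canonical_gensP H t : canonical_gens Delta r H t <-> exists2 g, canon H g
  & rr g = t.
Proof.
split.
- move=> h; have [Tt _] := h; have [g pg e] := reflsP Tt; exists g => //.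
  by apply/canonical_rootsE; split=> //; rewrite e.
- by move=> [g /canonical_rootsE[_ h] <-].
Qed.

Lemma canon_perm H g z : is_subgroup H -> canon H g -> Psi H z -> z <> g ->
  Psi H (refl g z).
Proof. by move=> sH [pg h] pz zg; apply: Psi_refl => //; apply: h. Qed.

(* Take the first factor of a reduced word of w whose root lies in the
   subsystem. *)
Lemma canon_in_Nset H w z : is_subgroup H -> Psi H z -> neg (act w z) ->
  exists2 g, canon H g & neg (act w g).
Proof.
move=> sH; have [n] := ubnP (len w); elim: n w z => // n IH w z /ltnSE wn pz nz.
have [w1|] := pselect (w^-1 = 1)%g.
  have [[_ pz'] _] := pz; case: (pos_not_neg pz').
  by move: nz; rewrite -[w]invgK w1 invg1 act1.
move=> /len_last[a Da]; rewrite lenV; pose u := (r a * w)%g.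
have uE : (u^-1 = w^-1 * r a)%g by rewrite invgM simpleV.
rewrite -uE lenV => lu.
have wE : w = (r a * u)%g by rewrite simpleKl.
have [[z' pz' nz']|h] := pselect (exists2 z', Psi H z' & neg (act u z')).
  have [|g cg ng] := IH u z' _ pz' nz'; first exact: leq_trans wn.
  exists g => //; have [[[rg pg] _] _] := cg.
  rewrite wE actM act_r // -reflN; apply: simple_perm => //.
    by apply/root_opp/root_act.
  move=> e; have : pos (act u^-1%g a).
    by apply: pos_of_len => //; rewrite uE simpleK // -uE !lenV.
  by rewrite -e actN actK => /pos_not_neg; rewrite opprK.
have pu y : Psi H y -> pos (act u y).
  move=> py; apply: root_not_neg; first by apply: root_act; case: py => -[].
  by move=> ny; apply: h; exists y.
have uz : act u z = a.
  apply: contrapT => uz; move: nz; rewrite wE actM act_r //.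
  apply: pos_not_neg; apply: simple_perm => //; last exact: pu.
  by apply: root_act; case: pz => -[].
exists z => //; split=> // y py yz.
have ry : Phi y by case: py => -[].
have rz : Phi z by case: pz => -[].
apply: root_not_neg; first exact: root_refl.
move=> ny; have := pu _ (Psi_refl_opp sH pz py ny).
rewrite actN act_refl uz; apply: pos_not_neg; apply: simple_perm => //.
- exact: root_act.
- exact: pu.
- by rewrite -uz => /act_inj.
Qed.

Lemma refl_neq_opp g z : PhiP g -> PhiP z -> z <> g -> - refl z g <> g.
Proof.
move=> pg pz zg e; apply: zg; apply/esym.
apply: (root_parallel (c := B g z)) => //.
apply: (@scalerI _ _ 2) => //; rewrite scalerA.
rewrite (_ : 2 *: g = g - - g); last by vec.
by rewrite -{2}e /reflection; vec.
Qed.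

(** The length drops twice: [rr z] negates [g], so [rr z * rr g] and its inverse [rr g * rr z] are
    shorter than [rr z]; and [rr g * rr z] still negates [g]. This length is the measure for
    [canon_ind]. *)
Lemma len_conj H g z : is_subgroup H -> canon H g -> Psi H z -> z <> g ->
  neg (refl z g) -> (len (rr (refl g z)) < len (rr z))%N.
Proof.
move=> sH cg pz zg ng; have [pg hg] := cg.
have [[rg _] _] := pg; have [[rz _] _] := pz.
have h : pos (refl g (- refl z g)).
  apply: hg; first exact: Psi_refl_opp.
  by apply: refl_neq_opp => //; [case: pg|case: pz].
rewrite rr_reflE //; apply: (@ltn_trans (len (rr g * rr z)%g)).
  apply/neg_len; first by case: pg.
  by rewrite actM !act_rr // -reflN.
have -> : (rr g * rr z = (rr z * rr g)^-1)%g by rewrite invgM !rrV.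
by rewrite lenV; apply/neg_len; [case: pg|rewrite act_rr].
Qed.

Lemma canon_exists H z : is_subgroup H -> Psi H z ->
  exists2 g, canon H g & neg (refl z g).
Proof.
move=> sH pz; have [[rz _] _] := pz.
have [|g cg] := canon_in_Nset (w := rr z) sH pz.
  by rewrite act_rr //; apply: neg_refl_self; case: pz.
by rewrite act_rr //; exists g.
Qed.

Lemma canon_ind H (P : V -> Prop) : is_subgroup H -> (forall g, canon H g -> P
  g) ->
  (forall g z, canon H g -> Psi H z -> z <> g -> P z -> P (refl g z)) ->
  forall z, Psi H z -> P z.
Proof.
move=> sH P1 PS z; have [n] := ubnP (len (rr z));
  elim: n z => // n IH z /ltnSE zn pz.
have [g cg ng] := canon_exists sH pz.
have [->|zg] := pselect (z = g); first exact: P1.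
have [pg _] := cg; have [[rg _] _] := pg.
rewrite -[z](reflK _ (root_norm rg)); apply: PS => //.
- exact: canon_perm.
- move=> e; have [[_ pz'] _] := pz; apply: (pos_not_neg pz').
  rewrite -[z](reflK _ (root_norm rg)) e; apply: neg_refl_self; by case: pg.
- apply: IH; last exact: canon_perm.
  exact: leq_trans (len_conj sH cg pz zg ng) zn.
Qed.

Lemma canonical_gens_invol H t : canonical_gens Delta r H t -> (t * t = 1)%g.
Proof. by move=> /canonical_gensP[g [[[rg _] _] _] <-]; apply: rrK. Qed.

Lemma canonical_gens_generate H : reflection_subgroup Delta r H ->
  H = generated (canonical_gens Delta r H).
Proof.
move=> [sH HE]; apply/seteqP; split.
- rewrite {1}HE => w; apply; first exact: generated_subgroup.
  move=> t [Ht /reflsP[z pz tE]]; rewrite -tE; have pz' : Psi H z by rewrite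
    /Psi tE.
  have [g1 gM _] := generated_subgroup (canonical_gens Delta r H).
  apply: (canon_ind (P := fun z => generated _ (rr z)) sH _ _ pz').
    by move=> g cg; apply: sub_generated; apply/canonical_gensP; exists g.
  move=> g y cg py _ gy; have gg : generated (canonical_gens Delta r H) (rr g).
    by apply: sub_generated; apply/canonical_gensP; exists g.
  rewrite rr_reflE; [|by case: cg => -[[]]|by case: py => -[]].
  by apply: (gM) => //; apply: (gM).
- by move=> w; apply=> // t /canonical_gensP[g [[_ Hg] _] <-].
Qed.

(* If c = B g h were positive, the roots h - 2cg and g - 2ch (when 2c >= 1), or
   (4c^2 - 1)h - 2cg (when 2c < 1), would be positive, against pos_neq0. *)
Lemma canon_le0 H g h : is_subgroup H -> canon H g -> canon H h -> g <> h ->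
  B g h <= 0.
Proof.
move=> sH cg ch gh; rewrite leNgt; apply/negP => c0.
have [pg _] := cg; have [ph _] := ch.
have [[rg pg'] _] := pg; have [[rh ph'] _] := ph.
have x1 := canon_perm sH cg ph (nesym gh).
have y1 := canon_perm sH ch pg gh.
have [c1|c1] := leP 1 (2 * B g h).
  apply: pos_neq0.
  rewrite (_ : 0 = refl g h + (2 * B g h) *: refl h g + (4 * B g h ^+ 2 - 1) *:
    h).
    apply: PLC_cone_add; last by apply: cone_scale; [nra|right].
    apply: PLC_add; first by case: x1 => -[].
    by apply: PLC_scale; [lra|case: y1 => -[]].
  by rewrite /reflection (BC h g); vec.
have x1h : refl g h <> h.
  move=> e; have := root_norm rg; suff -> : g = 0 by rewrite B0l; lra.
  apply: (@scalerI _ _ (2 * B g h)); first by apply/eqP; lra.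
  transitivity (h - refl g h); last by rewrite e subrr scaler0.
  by rewrite /reflection (BC h g); vec.
have [[_ x2] _] := canon_perm sH ch x1 x1h.
apply: pos_neq0.
rewrite (_ : 0 = refl h (refl g h) + (2 * B g h) *: g + (1 - 4 * B g h ^+ 2) *:
  h).
  apply: PLC_cone_add; last by apply: cone_scale; [nra|right].
  by apply: PLC_add => //; apply: PLC_scale => //; lra.
by rewrite /reflection !BE (BC h g) (root_norm rh); vec.
Qed.

(** * Planes and dihedral reflection subgroups *)

Definition plane x y : set V := [set v | exists p q, v = p *: x + q *: y].

Lemma plane_lin x y c u v : plane x y u -> plane x y v -> plane x y (u + c *:
  v).
Proof.
move=> [p [q ->]] [p' [q' ->]]; exists (p + c * p'), (q + c * q'); by vec.
Qed.

Lemma plane_l x y : plane x y x. Proof. by exists 1, 0; vec. Qed.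
Lemma plane_r x y : plane x y y. Proof. by exists 0, 1; vec. Qed.

Lemma plane_refl x y u v : plane x y u -> plane x y v -> plane x y (refl u v).
Proof.
move=> pu pv; rewrite /reflection (_ : _ - _ = v + (- (2 * B v u)) *: u);
  last by vec.
exact: plane_lin.
Qed.

Lemma plane_sub x y u v : plane x y u -> plane x y v -> plane u v `<=` plane x
  y.
Proof.
move=> [p1 [q1 ->]] [p2 [q2 ->]] _ [p [q ->]].
by exists (p * p1 + q * p2), (p * q1 + q * q2); vec.
Qed.

Lemma plane_exchange x y u v : PhiP u -> PhiP v -> u <> v -> plane x y u ->
  plane x y v -> plane u v x /\ plane u v y.
Proof.
move=> pu pv uv [p [q uE]] [p' [q' vE]].
have dx : (p * q' - p' * q) *: x = q' *: u - q *: v by rewrite uE vE; vec.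
have dy : (p * q' - p' * q) *: y = p *: v - p' *: u by rewrite uE vE; vec.
have [d0|d0] := eqVneq (p * q' - p' * q) 0; last first.
  split.
    exists (q' / (p * q' - p' * q)), (- q / (p * q' - p' * q)).
    by apply: (scalerI d0); rewrite dx; vec; field.
  exists (- p' / (p * q' - p' * q)), (p / (p * q' - p' * q)).
  by apply: (scalerI d0); rewrite dy; vec; field.
case: uv; move: dx dy; rewrite d0 !scale0r => /esym/subr0_eq ex /esym/subr0_eq
  ey.
have [p0|p0] := eqVneq p 0; last first.
  apply/esym; apply: (root_parallel (c := p^-1 * p')) => //.
  by rewrite -scalerA -ey scalerA mulVf // scale1r.
have [q0|q0] := eqVneq q 0; last first.
  apply/esym; apply: (root_parallel (c := q^-1 * q')) => //.
  by rewrite -scalerA ex scalerA mulVf // scale1r.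
have [ru _] := pu; have := root_norm ru.
rewrite uE p0 q0 !scale0r addr0 B0l => /eqP.
by rewrite eq_sym oner_eq0.
Qed.

Lemma canon_plane H a b : is_subgroup H -> canon H a -> canon H b ->
  (forall g, canon H g -> g = a \/ g = b) -> forall z, Psi H z -> plane a b z.
Proof.
move=> sH ca cb cab; have h g : canon H g -> plane a b g.
  by move=> /cab[->|->]; [exact: plane_l|exact: plane_r].
apply: (canon_ind sH h) => g z cg pz _ iz; apply: plane_refl => //; exact: h.
Qed.

(** A third canonical root [g = p a + q b] would pair nonpositively with [a] and [b]. Two positive
    coefficients give [B g g <= 0], mixed signs give [B g a > 0] or [B g b > 0], and two nonpositive
    ones make [g] negative. *)
Lemma canon_plane_le2 H a b g : is_subgroup H -> canon H a -> canon H b ->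
  a <> b -> canon H g -> plane a b g -> g = a \/ g = b.
Proof.
move=> sH ca cb ab cg [p [q gE]]; apply: contrapT => /not_orP[ga gb].
have ab0 := canon_le0 sH ca cb ab; have ga0 := canon_le0 sH cg ca ga.
have gb0 := canon_le0 sH cg cb gb.
have [[[ra pa] _] _] := ca; have [[[rb pb] _] _] := cb;
  have [[[rg pg] _] _] := cg.
have e1 : B g g = p * B g a + q * B g b by rewrite {2}gE !BE.
have e2 : B g a = p + q * B a b by rewrite gE !BE root_norm // (BC b a); ring.
have e3 : B g b = p * B a b + q by rewrite gE !BE root_norm //; ring.
rewrite root_norm // in e1.
have [p0|p0] := ltP 0 p; have [q0|q0] := ltP 0 q.
- by clear gE ga gb ab; nra.
- by clear gE ga gb ab; nra.
- by clear gE ga gb ab; nra.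
- apply: pos_neq0; rewrite (_ : 0 = g + ((- p) *: a + (- q) *: b));
    last by rewrite gE; vec.
  apply: PLC_cone_add => //.
  by apply: cone_add; apply: cone_scale; rewrite ?oppr_ge0 //; right.
Qed.

Lemma dihedralP H : dihedral Delta r H <-> reflection_subgroup Delta r H /\
  exists a b, [/\ canon H a, canon H b, a <> b & forall g, canon H g -> g = a
    \/ g = b].
Proof.
split=> -[rH].
- move=> /eq_cardSP[t ct /eq_cardSP[u [cu /= ut]]];
    rewrite II0 card_eq0 => /eqP e0.
  split=> //; have [a ca aE] := (canonical_gensP _ _).1 ct.
  have [b cb bE] := (canonical_gensP _ _).1 cu.
  exists a, b; split=> //; first by move=> ab; apply: ut; rewrite -bE -aE ab.
  move=> g cg; apply: contrapT => /not_orP[ga gb].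
  suff : set0 (rr g) by [].
  have rr_neq h : canon H h -> g <> h -> rr g <> rr h.
    by move=> ch gh /rr_inj e; apply: gh; apply: e;
      [case: cg => -[]|case: ch => -[]].
  rewrite -e0; split; last by rewrite /= -bE; apply: rr_neq.
  split; last by rewrite /= -aE; apply: rr_neq.
  by apply/canonical_gensP; exists g.
- move=> [a [b [ca cb ab h]]]; split=> //.
  have rab : rr b <> rr a.
    by move/rr_inj => e; apply: ab; apply/esym/e;
      [case: cb => -[]|case: ca => -[]].
  apply/eq_cardSP; exists (rr a); first by apply/canonical_gensP; exists a.
  apply/eq_cardSP; exists (rr b); first by split=> //; apply/canonical_gensP;
    exists b.
  rewrite II0 card_eq0; apply/eqP/seteqP; split=> // t.
  by move=> [[/canonical_gensP[g /h[->|->] <-] /= n1] /= n2].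
Qed.

Lemma refl_word_pow x y n : Phi x -> Phi y ->
  (rr x * (rr x * rr y) ^+ n = ((rr x * rr y) ^+ n)^-1 * rr x)%g.
Proof.
move=> rx ry; rewrite -rot_expV //.
elim: n => [|n IH]; first by rewrite mulg1 mul1g.
rewrite expgSr mulgA IH expgSr -!mulgA; congr (_ * _)%g.
by rewrite rrK // mulg1 mulgA rrK // mul1g.
Qed.

(** The rotation [g] has finite order, and every word in [rr a] and [rr b] has the normal form
    [g ^+ i * rr a ^+ e] with [e < 2]. *)
Lemma dihedral_finite H a b : reflection_subgroup Delta r H -> canon H a ->
  canon H b ->
  (forall g, canon H g -> g = a \/ g = b) -> -1 < B a b < 1 -> finite_set H.
Proof.
move=> rH ca cb cab dab.
have [[[ra _] _] _] := ca; have [[[rb _] _] _] := cb.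
have [p p0 gp] := rot_finite_order ra rb dab; set g := (rr a * rr b)%g in gp.
have gmod i : (g ^+ i = g ^+ (i %% p))%g.
  by rewrite {1}(divn_eq i p) expgnDr mulnC expgnA gp expg1n mul1g.
have gV i : exists j, ((g ^+ i)^-1 = g ^+ j)%g.
  exists (p.-1 * i)%N; apply: (mulIg (g ^+ i)%g);
    rewrite mulVg -expgnDr -mulSnr.
  by rewrite prednK // expgnA gp expg1n.
pose f (q : nat * nat) := (g ^+ q.1 * rr a ^+ q.2)%g.
apply: (sub_finite_set (B := f @` (`I_p `*` `I_2))); last first.
  by apply: finite_image; apply: finite_setX; apply: finite_II.
suff h w : H w -> exists i e, (e < 2)%N /\ w = (g ^+ i * rr a ^+ e)%g.
  move=> w /h[i [e [e2 ->]]]; exists (i %% p, e)%N; last by rewrite /f /= -gmod.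
  by split; rewrite //= ltn_pmod.
rewrite (canonical_gens_generate rH).
move=> /(generated_word (@canonical_gens_invol H))[s sH ->].
elim: s sH => [|t s IH] sH.
  by exists 0%N, 0%N; rewrite big_nil mul1g.
have [|i [e [e2 E]]] := IH; first by move=> u us; apply: sH;
  rewrite inE us orbT.
have La j e' : (e' < 2)%N ->
    exists i' e'', (e'' < 2)%N /\ (rr a * (g ^+ j * rr a ^+ e') = g ^+ i' * rr
      a ^+ e'')%g.
  move=> e'2; have [j' j'E] := gV j; rewrite mulgA refl_word_pow // j'E -mulgA.
  case: e' e'2 => [|[|//]] _; [exists j', 1%N|exists j', 0%N].
    by rewrite mulg1 expg1.
  by rewrite expg1 rrK.
rewrite big_cons E; have /canonical_gensP[h ch <-] := sH t (mem_head _ _).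
case: (cab h ch) => ->; first exact: La.
have [i' [e' [e'2 E']]] := La i.+1 e e2; exists i', e'; split=> //.
by rewrite -E' expgS !mulgA rrK // mul1g.
Qed.

Lemma dihedral_infinite_le H a b : reflection_subgroup Delta r H ->
  infinite_set H ->
  canon H a -> canon H b -> a <> b -> (forall g, canon H g -> g = a \/ g = b) ->
  B a b <= -1.
Proof.
move=> rH iH ca cb ab cab; rewrite leNgt; apply/negP => d; apply: iH.
apply: (dihedral_finite rH ca cb cab); rewrite d /=.
by apply: le_lt_trans (canon_le0 _ ca cb ab) ltr01; case: rH.
Qed.

(* The form is not positive definite on the plane spanned by an infinite
   dihedral root subsystem. *)
Lemma dihedral_infinite_ge1 H x y : dihedral Delta r H -> infinite_set H ->
  Psi H x -> Psi H y -> x <> y -> 0 < B x y -> 1 <= B x y.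
Proof.
move=> /dihedralP[rH [a [b [ca cb ab cab]]]] iH px py xy d0.
have ab1 := dihedral_infinite_le rH iH ca cb ab cab.
have sH : is_subgroup H by case: rH.
have pl := canon_plane sH ca cb cab.
have [[p [q aE]] [p' [q' bE]]] := plane_exchange px.1 py.1 xy (pl _ px) (pl _
  py).
have [[[ra pa] _] _] := ca; have [[[rb pb] _] _] := cb.
have [[rx _] _] := px; have [[ry _] _] := py.
rewrite leNgt; apply/negP => d1.
(* [a + b] is the witness: its norm is [2 + 2 B a b], whereas [0 < B x y < 1] would make the form
   positive definite on the plane. *)
have : B (a + b) (a + b) <= 0.
  by rewrite !BE !root_norm // (BC b a); clear aE bE ab xy; lra.
have e : a + b = (p + p') *: x + (q + q') *: y by rewrite {1}aE {1}bE; vec.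
have nz : a + b <> 0 by move=> e0; apply: pos_neq0; rewrite -e0; apply: PLC_add.
rewrite e !BE !root_norm // (BC y x).
set P := p + p' in e *; set Q := q + q' in e *.
have [P0|P0] := eqVneq P 0.
  have [Q0|Q0] := eqVneq Q 0; first by case: nz; rewrite e P0 Q0; vec.
  by move: Q0; rewrite P0; clear -d0 d1 => Q0; have : 0 < Q ^+ 2;
    [rewrite exprn_even_gt0|nra].
have : 0 < P ^+ 2 by rewrite exprn_even_gt0.
have : 0 <= Q ^+ 2 by rewrite exprn_even_ge0.
have : 0 <= (P + Q) ^+ 2 by rewrite exprn_even_ge0.
have : 0 <= (P - Q) ^+ 2 by rewrite exprn_even_ge0.
clear -d0 d1; nra.
Qed.

(** * Heights in infinite dihedral subgroups *)

Definition dominatedIn H x := dominated x `&` Psi H.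

Lemma dominatedIn_finite H x : PhiP x -> finite_set (dominatedIn H x).
Proof. by move=> px; apply: sub_finite_set (dominated_finite px) => y []. Qed.

Local Notation card A := (#|` fset_set A|).

(** [refl g] permutes [Psi H] away from [g] and transports dominance, so that only [g] itself can be
    gained. *)
Lemma dominatedIn_refl_sub H g z : is_subgroup H -> canon H g -> Psi H z -> z
  <> g ->
  dominatedIn H (refl g z) `\ g `<=` refl g @` (dominatedIn H z).
Proof.
move=> sH cg pz zg u [[[pu uz du] Pu] /= ug].
have [pg _] := cg; have [[rg _] _] := pg.
have [[rz _] _] := pz; have [ru _] := pu.
exists (refl g u); last by rewrite reflK // root_norm.
have pgu := canon_perm sH cg Pu ug.
split=> //; split; first by case: pgu.
  by move=> e; apply: uz; rewrite -e reflK // root_norm.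
rewrite -[z](reflK _ (root_norm rg)) -!(act_rr _ rg) -[act (rr g) z]/(act (rr
  g) z).
by apply: dom_act; rewrite act_rr.
Qed.

Lemma card_dominatedIn_refl H g z : is_subgroup H -> canon H g -> Psi H z -> z
  <> g ->
  (card (dominatedIn H (refl g z)) <= (card (dominatedIn H z)).+1)%N.
Proof.
move=> sH cg pz zg; have [pz' _] := pz.
have fz := dominatedIn_finite H pz'.
apply: leq_trans (card_subU1_le (finite_image _ fz) (dominatedIn_refl_sub sH cg
  pz zg)) _.
by rewrite ltnS; apply: card_image_le.
Qed.

Lemma card_dominatedIn_refl_ge H g z : is_subgroup H -> canon H g -> Psi H z ->
  z <> g ->
  (card (dominatedIn H z) <= (card (dominatedIn H (refl g z))).+1)%N.
Proof.
move=> sH cg pz zg; have [pg _] := cg; have [[rg _] _] := pg.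
rewrite -{1}[z](reflK _ (root_norm rg)); apply: card_dominatedIn_refl => //.
  exact: canon_perm.
move=> e; have [[_ pz'] _] := pz; apply: (pos_not_neg pz').
rewrite -[z](reflK _ (root_norm rg)) e; apply: neg_refl_self; by case: pg.
Qed.

Lemma dominatedIn_canon H g : canon H g -> dominatedIn H g = set0.
Proof.
move=> [pg h]; apply/seteqP; split=> // u [[pu ug du] Pu].
have [[rg _] _] := pg.
apply: (pos_not_neg (h u Pu ug)); rewrite -act_rr //; apply: du.
by rewrite act_rr //; apply: neg_refl_self; case: pg.
Qed.

(** The lower bound for heights: each letter lowers the count by at most one. Intermediate images of
    [z] may be negative, hence the statement up to sign. *)
Lemma dominatedIn_word H s z y : is_subgroup H ->
  (forall t, t \in s -> canonical_gens Delta r H t) -> Psi H z -> Psi H y ->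
  act (\prod_(t <- s) t)%g z = y \/ act (\prod_(t <- s) t)%g z = - y ->
  (card (dominatedIn H z) <= card (dominatedIn H y) + size s)%N.
Proof.
move=> sH sC pz; elim: s y sC => [|t s IH] y sC py.
  rewrite big_nil act1 addn0 => -[-> //|e]; case: (pos_not_neg pz.1.2).
  by rewrite e opprK; case: py => -[].
have [/canonical_gensP[g cg <-] sC'] : canonical_gens Delta r H t /\
    forall u : W, u \in s -> canonical_gens Delta r H u.
  by split=> [|u us]; apply: sC; rewrite inE ?us ?orbT ?eqxx.
rewrite big_cons actM; set v := act (\prod_(u <- s) u)%g z.
have [pg _] := cg; have [[rg _] _] := pg; rewrite act_rr // => h.
have gK u : refl g (refl g u) = u by rewrite reflK // root_norm.
have [z' pz' zv] : exists2 z', Psi H z' & v = z' \/ v = - z'.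
  have Hs : H (\prod_(u <- s) u)%g.
    case: (sH) => H1 HM _; rewrite big_seq; elim/big_rec: _ => // u w us;
      apply: (HM).
    by have /canonical_gensP[g' [[_ Hg'] _] <-] := sC' u us.
  have [p|p] := Psi_act sH Hs pz; [exists v|exists (- v)] => //;
    [left|right] => //.
  by rewrite opprK.
apply: leq_trans (IH z' sC' pz' zv) _; rewrite /= addnS -addSn leq_add2r.
have [->|zg] := pselect (z' = g).
  by rewrite (dominatedIn_canon cg) fset_set0 cardfs0.
have ygz : y = refl g z'.
  have pgz := canon_perm sH cg pz' zg.
  case: zv h => -> [e|e] //; first by case: (pos_not_neg pgz.1.2);
    rewrite e opprK; case: py => -[].
    case: (pos_not_neg py.1.2); rewrite -e reflN opprK; by case: pgz => -[].
  by move/(congr1 -%R): e; rewrite reflN !opprK.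
by rewrite ygz; apply: card_dominatedIn_refl_ge.
Qed.

(** The upper bound for heights. If [z] is not canonical, some canonical [g] has [refl z g]
    negative, so [B z g] is positive and therefore at least 1. Then [z] dominates [g], the converse
    being excluded because [refl g z] is positive. Reflecting in [g] loses [g] and gains nothing, as
    [B (refl g z) g <= -1]. *)
Lemma dominatedIn_reduce H z : dihedral Delta r H -> infinite_set H -> Psi H z
  ->
  exists s, [/\ (size s <= card (dominatedIn H z))%N,
    (forall t, t \in s -> canonical_gens Delta r H t) &
    canon H (act (\prod_(t <- s) t)%g z)].
Proof.
move=> dH iH; have sH : is_subgroup H by case: dH => -[].
have [n] := ubnP (card (dominatedIn H z)); elim: n z => // n IH z /ltnSE zn pz.
have [cz|ncz] := pselect (canon H z).
  by exists [::]; split=> //; rewrite big_nil act1.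
have [g cg ng] := canon_exists sH pz; have [pg hg] := cg.
have [[rg posg] _] := pg; have [[rz posz] _] := pz.
have gK u : refl g (refl g u) = u by rewrite reflK // root_norm.
have zg : z <> g by move=> e; apply: ncz; rewrite e.
have zg0 : 0 < B z g.
  rewrite ltNge; apply/negP => le0; apply: (pos_not_neg _ ng).
  rewrite (_ : refl z g = g + (- (2 * B g z)) *: z);
    last by rewrite /reflection; vec.
  apply: PLC_cone_add => //; apply: cone_scale; last by right.
  by rewrite (BC g z); clear zg; lra.
have zg1 := dihedral_infinite_ge1 dH iH pz pg zg zg0.
have dzg : dominatedIn H z g.
  split=> //; split; [by case: pg|exact: nesym|].
  have [//|gz] := dom_total pz.1 pg.1 zg1.
  case: (pos_not_neg (hg z pz zg)); rewrite -act_rr //; apply: gz.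
  by rewrite act_rr //; apply: neg_refl_self; case: pg.
have pgz := canon_perm sH cg pz zg.
have fz := dominatedIn_finite H pz.1.
have lt : (card (dominatedIn H (refl g z)) < card (dominatedIn H z))%N.
  apply: (@leq_ltn_trans (card (dominatedIn H z `\ g))); last first.
    by apply: (card_sub_lt fz (x := g)) => [u []||[_ /(_ erefl)]].
  apply: (card_inj_le (f := refl g)).
  - exact: sub_finite_set fz => u [].
  - move=> u hu; have ug : u <> g.
      move=> ug; have [[_ _ dgz] _] : dominatedIn H (refl g z) g by rewrite
        -{2}ug.
      have := dom_ge1 pgz.1 pg.1 dgz; rewrite /reflection !BE root_norm // ;
        clear zg ug; lra.
    have [u' du' e] := dominatedIn_refl_sub sH cg pz zg (conj hu ug).
    rewrite -e gK; split=> //= u'g; have [[[_ pu] _ _] _] := hu.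
    apply: (pos_not_neg pu); rewrite -e u'g; apply: neg_refl_self; by case: pg.
  - by move=> u1 u2 _ _ /(congr1 (refl g)); rewrite !gK.
  - by apply: dominatedIn_finite; case: pgz.
have [s [ss sC cs]] := IH _ (leq_trans lt zn) pgz.
exists (rcons s (rr g)); split.
- by rewrite size_rcons; apply: leq_ltn_trans lt.
- move=> t; rewrite mem_rcons inE => /orP[/eqP ->|/sC //].
  by apply/canonical_gensP; exists g.
- by rewrite -cats1 big_cat /= big_seq1 actM act_rr.
Qed.

Lemma word_in_subgroup H s : is_subgroup H ->
  (forall t, t \in s -> canonical_gens Delta r H t) -> H (\prod_(t <- s) t)%g.
Proof.
move=> [H1 HM _] sC; rewrite big_seq; elim/big_rec: _ => // u w us; apply: (HM).
by have /canonical_gensP[g' [[_ Hg'] _] <-] := sC u us.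
Qed.

Lemma height_dominated H x : dihedral Delta r H -> infinite_set H -> Psi H x ->
  height B Delta r act H (rr x) = card (dominatedIn H x).
Proof.
move=> dH iH px; have rH : reflection_subgroup Delta r H by case: dH.
have sH : is_subgroup H by case: rH.
have inv := @canonical_gens_invol H.
have [s [ss sC cs]] := dominatedIn_reduce dH iH px.
pose P := [set n | exists w, [/\ H w,
    canonical_roots B Delta r act H (act w x)
    & n = word_length (canonical_gens Delta r H) w]].
have Ps : P (word_length (canonical_gens Delta r H) (\prod_(t <- s) t)%g).
  exists (\prod_(t <- s) t)%g; split=> //; first exact: word_in_subgroup.
  exact/canonical_rootsE.
rewrite /height root_of_refl_rr; last by case: px.
rewrite -/P; have [[w [Hw cw ->]] minP] := nat_minP (ex_intro _ _ Ps).
apply/eqP; rewrite eqn_leq; apply/andP; split.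
  case: cw => _ _; apply: leq_trans (minP _ Ps) _; apply: leq_trans ss.
  exact: word_length_le.
have gw : generated (canonical_gens Delta r H) w by rewrite
  -canonical_gens_generate.
have [s' [<- s'C wE]] := word_lengthP inv gw.
move/canonical_rootsE: cw => cw; rewrite wE in cw.
have := dominatedIn_word sH s'C px cw.1 (or_introl erefl).
by rewrite (dominatedIn_canon cw) fset_set0 cardfs0.
Qed.

(** * Maximal dihedral subgroups as groups of planes *)

Definition plane_group x y : set W := generated [set rr z | z in PhiP `&` plane
  x y].

Lemma generated_min (A H : set W) : is_subgroup H -> A `<=` H -> generated A
  `<=` H.
Proof. by move=> sH AH w; apply. Qed.

Lemma plane_groupE x y z : Psi (plane_group x y) z <-> PhiP z /\ plane x y z.
Proof.
split=> -[pz h]; split=> //; last by apply: sub_generated; exists z.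
(* The elements moving every vector by a vector of the plane form a subgroup; a reflection [rr z] in
   it moves [z] by [- 2 z], so that [z] lies in the plane. *)
pose K : set W := [set w | forall v, plane x y (act w v - v)].
have p0 : plane x y 0 by exists 0, 0; vec.
have sK : is_subgroup K.
  split=> [v|w1 w2 h1 h2 v|w hw v]; first by rewrite act1 subrr.
    rewrite actM (_ : _ - v = (act w1 (act w2 v) - act w2 v) + 1 *: (act w2 v -
      v)); last by vec.
    exact: plane_lin.
  rewrite -{2}[v](actVK w) (_ : _ - _ = 0 + (-1) *: (act w (act w^-1%g v) - act
    w^-1%g v)).
    exact: plane_lin.
  by vec.
have : K (rr z).
  apply: generated_min sK _ _ h => _ [u [pu Pu] <-] v.
  rewrite act_rr; last by case: pu.
  by rewrite /reflection (_ : _ - v = 0 + (- (2 * B v u)) *: u);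
    [exact: plane_lin|vec].
move=> /(_ z); have [rz _] := pz; rewrite act_rr // refl_self ?root_norm // =>
  hz.
rewrite (_ : z = 0 + (- 2^-1) *: (- z - z)); first exact: plane_lin.
by vec; field.
Qed.

Lemma plane_group_refl x y : reflection_subgroup Delta r (plane_group x y).
Proof.
have sH : is_subgroup (plane_group x y) by apply: generated_subgroup.
split=> //; apply/seteqP; split.
- apply: generated_min; first exact: generated_subgroup.
  move=> _ [z [pz Pz] <-]; apply: sub_generated; split.
    by apply: sub_generated; exists z.
  by apply: rr_refl; case: pz.
- by apply: generated_min => // w [].
Qed.

(** A single canonical root would be the only root of the group, which contains both [x] and [y];
    three are excluded by [canon_plane_le2], since any two distinct positive roots of the plane span
    it. *)
Lemma plane_group_dihedral x y : PhiP x -> PhiP y -> x <> y ->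
  dihedral Delta r (plane_group x y).
Proof.
move=> px py xy; have rH := plane_group_refl x y.
have sH : is_subgroup (plane_group x y) by case: rH.
have Px : Psi (plane_group x y) x by apply/plane_groupE; split=> //;
  apply: plane_l.
have Py : Psi (plane_group x y) y by apply/plane_groupE; split=> //;
  apply: plane_r.
have [a ca _] := canon_exists sH Px.
have [b cb ab] : exists2 b, canon (plane_group x y) b & a <> b.
  apply: contrapT => h.
  have ha g : canon (plane_group x y) g -> g = a.
    by move=> cg; apply: contrapT => ga; apply: h; exists g => //; apply: nesym.
  have za z : Psi (plane_group x y) z -> z = a.
    apply: (canon_ind sH ha) => g u cg _ ug ua.
    by case: ug; rewrite (ha g cg).
  by apply: xy; rewrite (za x) // (za y).
apply/dihedralP; split=> //; exists a, b; split=> // g cg.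
apply: (canon_plane_le2 sH ca cb ab cg).
have [[pa _] _] := ca; have [[pb _] _] := cb.
have [/plane_groupE[_ Pa] _] := ca; have [/plane_groupE[_ Pb] _] := cb.
have [xab yab] := plane_exchange pa pb ab Pa Pb.
have [/plane_groupE[_ Pg] _] := cg.
exact: plane_sub xab yab _ Pg.
Qed.

Lemma dihedral_sub_plane H x y : dihedral Delta r H -> Psi H x -> Psi H y -> x
  <> y ->
  H `<=` plane_group x y.
Proof.
move=> /dihedralP[rH [a [b [ca cb ab cab]]]] px py xy.
have sH : is_subgroup H by case: rH.
have pl := canon_plane sH ca cb cab.
have [axy bxy] := plane_exchange px.1 py.1 xy (pl _ px) (pl _ py).
case: rH => _ HE; rewrite {1}HE; apply: generated_min;
  first exact: generated_subgroup.
move=> t [Ht /reflsP[z pz tE]]; apply: sub_generated; exists z => //;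
  split=> //.
by apply: plane_sub axy bxy _ _; apply: pl; rewrite /Psi tE.
Qed.

Lemma maximal_dihedralP H x y : PhiP x -> PhiP y -> x <> y ->
  maximal_dihedral Delta r H /\ H (rr x) /\ H (rr y) <-> H = plane_group x y.
Proof.
move=> px py xy; split.
- move=> [[dH maxH] [Hx Hy]].
  by rewrite (maxH _ (plane_group_dihedral px py xy)) //;
    apply: dihedral_sub_plane.
- move=> ->; have Px : Psi (plane_group x y) x.
    by apply/plane_groupE; split=> //; apply: plane_l.
  have Py : Psi (plane_group x y) y by apply/plane_groupE; split=> //;
    apply: plane_r.
  case: (Px) (Py) => _ Hx [_ Hy]; split=> //; split.
    exact: plane_group_dihedral.
  move=> H' dH' sub; apply/seteqP; split=> //.
  by apply: dihedral_sub_plane => //; split=> //; apply: sub.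
Qed.

Lemma plane_group_infinite x y : PhiP x -> PhiP y -> x <> y -> dom x y ->
  infinite_set (plane_group x y).
Proof.
move=> px py xy dxy fin; have d1 := dom_ge1 px py dxy.
pose z n := rec2 (B x y) y x n.+1.
have pz n : PhiP (z n).
  split; last exact: dom_rec2_pos.
  by apply: rec2_root; [case: py|case: px|rewrite BC].
apply: (finite_no_inj (f := fun n => rr (z n)) fin) => [n|m n].
  apply: sub_generated; exists (z n) => //; split=> //.
  by rewrite /z rec2E; exists (cheb (B x y) n.+1), (- cheb (B x y) n); vec.
by move=> /(rr_inj (pz m) (pz n)); apply: rec2_inj.
Qed.

(** Each dominated [y] is sorted into [plane_group x y]. The fibre over [H] consists of the
    dominated roots in [H], and their number is the height in [H]. *)
Lemma inf_height_dominated x : PhiP x ->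
  inf_height B Delta r act (rr x) = card (dominated x).
Proof.
move=> px; set M := [set H | [/\ maximal_dihedral Delta r H, infinite_set H & H
  (rr x)]].
have key y : dominated x y -> M (plane_group x y).
  move=> [py yx xy]; have := (maximal_dihedralP (plane_group x y) px py (nesym
    yx)).2 erefl.
  by move=> [? [? _]]; split=> //; apply: plane_group_infinite => //;
    apply: nesym.
rewrite -(fsbig_card_fibers (dominated_finite px) key) /inf_height -/M.
apply: eq_fsbigr => H; rewrite inE => -[mH iH Hx].
have Px : Psi H x by [].
rewrite height_dominated //; last by case: mH.
congr (card _); apply/seteqP; split=> y.
  move=> [dy [_ Hy]]; split=> //; have [py yx xy] := dy.
  by apply/esym/(maximal_dihedralP H px py (nesym yx)).
move=> [dy e]; split=> //; have [py yx xy] := dy; split=> //.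
by have [_ []] := (maximal_dihedralP H px py (nesym yx)).2 (esym e).
Qed.

(** * Reflection in an elementary root *)

Lemma dominated_lt x y : PhiP x -> dominated x y ->
  (card (dominated y) < card (dominated x))%N.
Proof.
move=> px [py yx xy]; apply: (card_sub_lt (x := y) (dominated_finite px)) => //.
- move=> u [pu uy yu]; split=> //; last exact: dom_trans yu.
  by move=> ux; apply: yx; apply: dom_antisym => //; rewrite -ux.
- by case.
Qed.

Definition elementary x := PhiP x /\ dominated x = set0.

Lemma elementary_dominated x : PhiP x -> dominated x !=set0 ->
  exists2 y, elementary y & dominated x y.
Proof.
have [n] := ubnP (card (dominated x)); elim: n x => // n IH x /ltnSE xn px [y
  xy].
have [py yx dxy] := xy.
have [e|/set0P ne] := eqVneq (dominated y) set0; first by exists y.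
have [|y' ey' [py' y'y dyy']] := IH y _ py ne.
  exact: leq_trans (dominated_lt px xy) xn.
exists y' => //; split=> //; last exact: dom_trans dyy'.
by move=> e; apply: yx; apply: dom_antisym => //; rewrite -e.
Qed.

Lemma elementary_below z : PhiP z -> exists2 y, elementary y & dom z y.
Proof.
move=> pz; have [e|/set0P ne] := eqVneq (dominated z) set0; first by exists z.
by have [y ey [_ _ zy]] := elementary_dominated pz ne; exists y.
Qed.

Lemma elementary_comparable x y : elementary x -> elementary y -> 1 <= B x y ->
  x = y.
Proof.
move=> [px ex] [py ey] /(dom_total px py) [xy|yx]; apply: contrapT => n.
- suff : dominated x y by rewrite ex.
  by split=> //; apply: nesym.
- suff : dominated y x by rewrite ey.
  by split.
Qed.

(* Reflecting x in an elementary root y that it dominates. The map sending u to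
   refl y u if this is positive, and to u otherwise, embeds the roots dominated
   by refl y x into those dominated by x other than y. *)
Lemma dominated_refl x y : PhiP x -> elementary y -> dominated x y ->
  [/\ PhiP (refl y x), (card (dominated (refl y x)) < card (dominated x))%N
    & ~ dom (refl y x) y].
Proof.
move=> px [py ey] [_ yx xy].
have [rx posx] := px; have [ry posy] := py.
have yK u : refl y (refl y u) = u by rewrite reflK // root_norm.
have pz : PhiP (refl y x).
  split; first exact: root_refl.
  apply: root_not_neg; first exact: root_refl.
  (* Transporting [dom x y] by [rr y] gives [dom (refl y x) (- y)], that is, [y] dominates
     [- refl y x]; for an elementary [y] this cannot be another positive root. *)
  move=> nz; suff : dominated y (- refl y x) by rewrite ey.
  split.
  - by split=> //; apply/root_opp/root_refl.
  - by move=> e; apply: yx; rewrite -[x]yK -[refl y x]opprK e reflN refl_self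
      ?opprK ?root_norm.
  - rewrite -[y in dom y _]opprK; apply: dom_opp; first exact: root_refl.
      exact: root_opp.
    have := dom_act (w := rr y) xy.
    by rewrite !act_rr // refl_self ?root_norm.
have nzy : ~ dom (refl y x) y.
  move=> /(dom_ge1 pz py); rewrite /reflection !BE root_norm //.
  by have := dom_ge1 px py xy; clear yx ey; lra.
split=> //.
pose f u := if `[< pos (refl y u) >] then refl y u else u.
apply: (@leq_ltn_trans (card (dominated x `\ y))); last first.
  by apply: (card_sub_lt (x := y) (dominated_finite px)) => [u []||[_ /(_
    erefl)]].
apply: (card_inj_le (f := f)).
- by apply: sub_finite_set (dominated_finite px) => u [].
- move=> u [[ru posu] uz zu]; rewrite /f.
  have xyu : dom x (refl y u).
    have := dom_act (w := rr y) zu; by rewrite !act_rr // yK.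
  case: asboolP => [p|np]; split.
  + split=> //; first by split=> //; apply: root_refl.
    by move=> e; apply: uz; rewrite -e yK.
  + move=> /= e; apply: (pos_not_neg posu); rewrite -[u]yK e.
    exact: neg_refl_self.
  + have nu : neg (refl y u) by apply: root_not_pos => //; apply: root_refl.
    split=> //; first by move=> e; apply: np; rewrite e; case: pz.
    (* [u] is [refl y u] plus a multiple of [y], positive because [refl y u] is negative. Any [w]
       that negates [x] negates both terms, hence also [u]. *)
    move=> w nx; have := xy w nx; have := xyu w nx => nwu nwy.
    have uy0 : 0 < B u y.
      rewrite ltNge; apply/negP => le0; apply: np.
      rewrite (_ : refl y u = u + (- (2 * B u y)) *: y);
        last by rewrite /reflection; vec.
      apply: PLC_cone_add => //; apply: cone_scale; last by right.
      by rewrite oppr_ge0 pmulr_rle0.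
    rewrite (_ : - act w u = - act w (refl y u) + (2 * B u y) *: (- act w y)).
      by apply: PLC_add => //; apply: PLC_scale => //; rewrite mulr_gt0.
    by rewrite /reflection !actE; vec.
  + by move=> /= e; apply: nzy; rewrite -{2}e.
- move=> u1 u2 [[_ p1] _ _] [[_ p2] _ _]; rewrite /f.
  case: asboolP => h1; case: asboolP => h2 //.
  + by move/(congr1 (refl y)); rewrite !yK.
  + by move=> e; case: h2; rewrite -e yK.
  + by move=> e; case: h1; rewrite e yK.
- by apply: dominated_finite.
Qed.

(** * Counting reflections of a given infinity-height *)

Local Notation Tn := (refls_of_height B Delta r act).

Lemma refls_of_heightE n : Tn n = rr @` [set x | PhiP x /\ card (dominated x) =
  n].
Proof.
apply/seteqP; split=> [t [/reflsP[x px <-]]|_ [x [px xn] <-]].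
  by rewrite inf_height_dominated // => xn; exists x.
by split; [apply: rr_refl; case: px|rewrite inf_height_dominated].
Qed.

Lemma refls_of_height0E : Tn 0 = rr @` elementary.
Proof.
rewrite refls_of_heightE; congr (_ @` _); apply/seteqP; split=> x [px h];
  split=> //.
  apply/seteqP; split=> // y xy.
  have : (card (dominated y) < card (dominated x))%N by apply: dominated_lt.
  by rewrite h.
by rewrite h fset_set0 cardfs0.
Qed.

Lemma refls_of_height_step n x : PhiP x -> card (dominated x) = n.+1 ->
  exists y z, [/\ elementary y, PhiP z, (card (dominated z) <= n)%N,
    ~ dom z y & x = refl y z].
Proof.
move=> px xn; have ne : dominated x !=set0.
  by apply/set0P/eqP => e; move: xn; rewrite e fset_set0 cardfs0.
have [y ey xy] := elementary_dominated px ne; have [[ry _] _] := ey.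
have [pz zx nzy] := dominated_refl px ey xy; exists y, (refl y x); split=> //.
  by rewrite -ltnS -xn.
by rewrite reflK // root_norm.
Qed.

Lemma refls_of_height_conj n : (0 < n)%N -> Tn n `<=` [set u : W | exists t t'
  : W,
  [/\ Tn 0 t, exists2 m : nat, (m <= n - 1)%N & Tn m t' & u = (t * t' * t)%g]].
Proof.
case: n => // n _; rewrite refls_of_heightE => _ [x [px xn] <-].
have [y [z [ey pz zn _ ->]]] := refls_of_height_step px xn.
exists (rr y), (rr z); split.
- by rewrite refls_of_height0E; exists y.
- exists (card (dominated z)); first by rewrite subSS subn0.
  by rewrite refls_of_heightE; exists z.
- by apply: rr_reflE; [case: ey => -[]|case: pz].
Qed.

Definition height_lt n : set V := [set x | PhiP x /\ (card (dominated x) <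
  n)%N].

Lemma height_lt_bound n : finite_set elementary ->
  [/\ finite_set (height_lt n.+1), (card (height_lt n.+1) <= card elementary ^
    n.+1)%N,
    finite_set [set x | PhiP x /\ card (dominated x) = n.+1] &
    (card [set x | PhiP x /\ card (dominated x) = n.+1]
      <= card (height_lt n.+1) * (card elementary - 1))%N].
Proof.
move=> fE.
have step m : finite_set (height_lt m.+1) ->
    finite_set [set x | PhiP x /\ card (dominated x) = m.+1] /\
    (card [set x | PhiP x /\ card (dominated x) = m.+1]
      <= card (height_lt m.+1) * (card elementary - 1))%N.
  move=> fU.
  have [e he] : exists e : V -> V, forall z, PhiP z -> elementary (e z) /\ dom
    z (e z).
    suff /choice[e he] : forall z, exists y, PhiP z -> elementary y /\ dom z y
      by exists e.
    move=> z; have [pz|npz] := pselect (PhiP z); last by exists 0.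
    by have [y ey zy] := elementary_below pz; exists y.
  apply: (card_pairs_le (f := reflection B) (E := e) fU fE) => [z [pz _]|x [px
    xm]].
    by case: (he z pz).
  have [y [z [ey pz zm nzy xE]]] := refls_of_height_step px xm.
  exists y, z; split=> //.
  by move=> yz; apply: nzy; rewrite yz; case: (he z pz).
have h : finite_set (height_lt n.+1) /\ (card (height_lt n.+1) <= card
  elementary ^ n.+1)%N.
  elim: n => [|n [fU cU]].
    have -> : height_lt 1 = elementary.
      apply/seteqP; split=> x [px h]; split=> //;
        last by rewrite h fset_set0 cardfs0.
      apply/seteqP; split=> // y /(dominated_lt px); move: h;
        rewrite ltnS leqn0 => /eqP ->.
      by rewrite ltn0.
    by rewrite expn1.
  have [fD cD] := step n fU.
  have UE : height_lt n.+2 = height_lt n.+1 `|` [set x | PhiP x /\ card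
    (dominated x) = n.+1].
    apply/seteqP; split=> x.
      by move=> [px]; rewrite ltnS leq_eqVlt => /orP[/eqP|]; [right|left].
    by move=> [[px h]|[px h]]; split=> //; [apply: ltnW|rewrite h].
  rewrite UE; split; first by rewrite finite_setU.
  rewrite fset_setU //; apply: leq_trans (leq_card_fsetU _ _) _.
  apply: leq_trans (leq_add (leqnn _) cD) _.
  case: (card elementary) cU => [|a] cU.
    by move: cU; rewrite exp0n // leqn0 => /eqP ->.
  by rewrite subSS subn0 -mulnS expnSr leq_mul2r cU orbT.
have [fU cU] := h; have [fD cD] := step n fU; by split.
Qed.

(** This embeds [W] into the power set of the positive roots, so an infinite [W] has infinitely many
    of them. *)
Lemma Nset_inj w1 w2 : Nset w1 = Nset w2 -> w1 = w2.
Proof.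
move=> e; suff h : (w1 * w2^-1 = 1)%g by apply: (mulIg w2^-1%g);
  rewrite h mulgV.
apply: act_pos_eq1 => a Da; rewrite actM; set y := act w2^-1%g a.
have ry : Phi y by apply: root_act; apply: simple_root.
have w2y : act w2 y = a by rewrite /y actVK.
have [py|ny] := root_pos_neg ry.
  apply: root_not_neg => [|n1]; first exact: root_act.
  have [_] : Nset w2 y by rewrite -e.
  by rewrite w2y => /(pos_not_neg (PLC_mem Da)).
have [_] : Nset w1 (- y).
  rewrite e; split; first by split=> //; apply: root_opp.
  by rewrite actN w2y opprK; apply: PLC_mem.
by rewrite actN opprK.
Qed.

Lemma infinite_pos_roots : infinite_set [set: W] -> infinite_set PhiP.
Proof.
move=> iW fP; apply: iW.
apply: sub_finite_set (finite_preimage (f := Nset) _ (finite_powerset fP)).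
  by move=> w _ x [].
by move=> w1 w2 _ _; apply: Nset_inj.
Qed.

Lemma subgroupT : is_subgroup [set: W]. Proof. by split. Qed.

Lemma dominatedInT x : dominatedIn [set: W] x = dominated x.
Proof. by apply/seteqP; split=> y; [case|move=> h; split=> //; case: h]. Qed.

(* Each reflection in a canonical root changes the number of dominated roots by
   at most one. *)
Lemma dominated_values x n : PhiP x -> (n <= card (dominated x))%N ->
  exists2 y, PhiP y & card (dominated y) = n.
Proof.
have [m] := ubnP (len (rr x)); elim: m x => // m IH x /ltnSE xm px.
rewrite leq_eqVlt => /orP[/eqP ->|lt]; first by exists x.
have Px : Psi [set: W] x by [].
have [g cg ng] := canon_exists subgroupT Px.
have xg : x <> g.
  move=> e; move: lt; rewrite -dominatedInT e dominatedIn_canon //.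
  by rewrite fset_set0 cardfs0.
have [pz _] := canon_perm subgroupT cg Px xg.
apply: (IH (refl g x)) => //.
  exact: leq_trans (len_conj subgroupT cg Px xg ng) xm.
rewrite -ltnS; apply: leq_trans lt _.
by have := card_dominatedIn_refl_ge subgroupT cg Px xg; rewrite !dominatedInT.
Qed.

Lemma refls_of_height_neq0 n : infinite_set [set: W] -> finite_set elementary ->
  exists2 y, PhiP y & card (dominated y) = n.
Proof.
move=> iW fE; have [x px xn] : exists2 x, PhiP x & (n <= card (dominated x))%N.
  apply: contrapT => h; apply: (infinite_pos_roots iW).
  have [fU _ _ _] := height_lt_bound n fE.
  apply: sub_finite_set fU => x px; split=> //; rewrite ltnS leqNgt.
  by apply/negP => lt; apply: h; exists x => //; apply: ltnW.
exact: dominated_values xn.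
Qed.

Lemma simple_finite : finite_set (simple_refls Delta r) -> finite_set Delta.
Proof.
move=> fS; apply: sub_finite_set (finite_image alpha fS) => a Da.
exists (r a); first by exists a.
by rewrite -rr_simple // root_of_refl_rr //; apply: simple_PhiP.
Qed.

Lemma card_refls_of_height n : finite_set [set x | PhiP x /\ card (dominated x)
  = n] ->
  finite_set (Tn n) /\ card (Tn n) = card [set x | PhiP x /\ card (dominated x)
    = n].
Proof.
move=> fD; rewrite refls_of_heightE; split; first exact: finite_image.
rewrite fset_set_image // card_in_imfset //= => x y.
by rewrite !in_fset_set // !inE => -[px _] [py _]; apply: rr_inj.
Qed.

Lemma refls_of_height_card : finite_set elementary -> infinite_set [set: W] ->
  finite_set (Tn 0) /\ forall n, (0 < n)%N ->
   [/\ finite_set (Tn n), (0 < card (Tn n))%N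
     & (card (Tn n) <= card (Tn 0) ^ n.+1 - card (Tn 0) ^ n)%N].
Proof.
move=> fE iW.
have e0 : [set x | PhiP x /\ card (dominated x) = 0%N] = elementary.
  apply/seteqP; split=> x [px h]; split=> //; last by rewrite h fset_set0
    cardfs0.
  apply/seteqP; split=> // y /(dominated_lt px); by rewrite h.
have [f0 c0] : finite_set (Tn 0) /\ card (Tn 0) = card elementary.
  by rewrite -e0; apply: card_refls_of_height; rewrite e0.
split=> // -[//|n] _; rewrite c0.
have [fU cU fD cD] := height_lt_bound n fE.
have [fT cT] := card_refls_of_height fD; split=> //.
  have [y py yn] := refls_of_height_neq0 n.+1 iW fE.
  rewrite cT cardfs_gt0; apply/fset0Pn; exists y.
  by rewrite in_fset_set // inE.
rewrite cT; apply: leq_trans cD _; apply: leq_trans (leq_mul cU (leqnn _)) _.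
by rewrite mulnBr muln1 -expnSr.
Qed.

(** * Finiteness of the set of elementary roots *)

(** Values on a linearly dependent [Delta] cannot be prescribed freely. By (C2) the space of linear
    relations contains no nonzero nonnegative vector, so Gordan's theorem provides positive values
    compatible with all relations; they define [f] on the span [L]. *)
Lemma positive_functional : finite_set Delta -> exists (L : set V) (f : V -> R),
  [/\ L 0, (forall a, Delta a -> L a), (forall c u v, L u -> L v -> L (u + c *:
    v)),
    (forall c u v, L u -> L v -> f (u + c *: v) = f u + c * f v)
    & forall a, Delta a -> 0 < f a].
Proof.
move=> fD; pose e i := nth 0 (fset_set Delta) i; pose n := card Delta.
pose comb (c : nat -> R) : V := \sum_(i < n) c i *: e i.
have combD (c : R) (u v : nat -> R) :
    comb (fun i => u i + c * v i) = comb u + c *: comb v.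
  rewrite /comb scaler_sumr -big_split; apply: eq_bigr => i _ /=.
  by rewrite scalerDl scalerA.
have De i : (i < n)%N -> Delta (e i).
  by move=> ilt; have := mem_nth 0 ilt; rewrite in_fset_set // inE.
have sK : subspace n (fun c => comb c = 0).
  split.
  - by rewrite /comb big1 // => i _; rewrite scale0r.
  - by move=> c u v u0 v0; rewrite combD u0 v0 scaler0 addr0.
  - move=> u v uv <-; apply: eq_bigr => i _; by rewrite uv // ltn_ord.
have [|phi phi0 phiK] := gordan sK.
  move=> u u0 ge0 i ilt; apply: contrapT => ui; apply: pos_neq0;
    rewrite -u0 /comb.
  rewrite -(big_mkord xpredT (fun i => u i *: e i)); apply: PLC_sum.
  - by move=> j; rewrite mem_index_iota => /De.
  - by move=> j; rewrite mem_index_iota => /ge0.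
  - exists i; first by rewrite mem_index_iota.
    by rewrite lt_neqAle ge0 // andbT eq_sym; apply/eqP.
(* The value does not depend on the expression of [v], because [phi] vanishes on relations. Outside
   the span it is 0 by default. *)
pose f v := xget 0 [set t | exists2 c, v = comb c & t = pairing n phi c].
have fE c : f (comb c) = pairing n phi c.
  have [c' cc' ->] : [set t | exists2 c', comb c = comb c' & t = pairing n phi
    c'] (f (comb c)).
    by apply: xgetPex; exists (pairing n phi c), c.
  apply/eqP; rewrite -subr_eq0 -[pairing n phi c]mul1r -mulN1r mul1r
    -pairing_lin.
  by apply/eqP/phiK; rewrite combD cc'; vec.
exists [set v | exists c, v = comb c], f; split.
- by exists (fun=> 0); have [-> _ _] := sK.
- move=> a Da; pose i := index a (fset_set Delta).
  have ilt : (i < n)%N by rewrite index_mem in_fset_set // inE.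
  exists (fun j => (j == i)%:R); rewrite /comb (bigD1 (Ordinal ilt)) //= eqxx
    scale1r.
  rewrite big1 ?addr0 => [|j /eqP ji].
    by rewrite /e nth_index // in_fset_set // inE.
  case: eqP => [jE|_]; last by rewrite scale0r.
  by case: ji; apply: val_inj.
- by move=> c _ _ [u ->] [v ->]; exists (fun i => u i + c * v i); rewrite combD.
- by move=> c _ _ [u ->] [v ->]; rewrite -combD !fE pairing_lin.
- move=> a Da; pose i := index a (fset_set Delta).
  have ilt : (i < n)%N by rewrite index_mem in_fset_set // inE.
  have -> : a = comb (fun j => (j == i)%:R).
    rewrite /comb (bigD1 (Ordinal ilt)) //= eqxx scale1r.
    rewrite big1 ?addr0 => [|j /eqP ji].
      by rewrite /e nth_index // in_fset_set // inE.
    case: eqP => [jE|_]; last by rewrite scale0r.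
    by case: ji; apply: val_inj.
  rewrite fE; apply: pairing_gt0 => //.
  by exists i; rewrite // eqxx; apply/eqP; rewrite oner_eq0.
Qed.

(* Averaging a positive functional over the finite group generated by the
   rotation rr x * rr y gives a functional that vanishes on x and y and is
   positive on almost all positive roots. Some element of W moves it to one that
   is nonnegative on Delta; the roots where the latter vanishes form a finite
   parabolic subsystem. *)
Lemma finite_parabolic x y : finite_set Delta -> Phi x -> Phi y -> -1 < B x y <
  1 ->
  exists w I, [/\ I `<=` Delta, finite_set (PhiP `&` PLC I),
    PLC I (act w x) \/ PLC I (- act w x) & PLC I (act w y) \/ PLC I (- act w
      y)].
Proof.
move=> fD rx ry dxy; have [L [f [L0 LD LL fL fpos]]] := positive_functional fD.
have [p p0 gp] := rot_finite_order rx ry dxy; set g := (rr x * rr y)%g in gp.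
have f0 : f 0 = 0.
  by have := fL 1 0 0 L0 L0; rewrite scaler0 addr0 mul1r; lra.
have LZ c v : L v -> L (c *: v) by move=> Lv; rewrite -[_ *: _]add0r; apply: LL.
have fZ c v : L v -> f (c *: v) = c * f v.
  by move=> Lv; rewrite -[_ *: _]add0r fL // f0 add0r.
have LA w v : L v -> L (act w v).
  elim/W_ind: w v => [|a w Da IH] v Lv; first by rewrite act1.
  rewrite actM act_r // /reflection -scaleNr; apply: LL; [exact: IH|exact: LD].
have Lroot z : Phi z -> L z by move=> [w [a [Da ->]]]; apply/LA/LD.
have fPLC v : pos v -> L v /\ 0 < f v.
  elim/PLC_ind => [c a c0 Da|u v' [Lu fu] [Lv fv]].
    by split; [apply/LZ/LD|rewrite fZ ?mulr_gt0 ?fpos //; apply: LD].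
  by rewrite -[v']scale1r; split; [apply: LL|rewrite fL // mul1r addr_gt0].
pose F v := \sum_(i < p) f (act (g ^+ i)%g v).
have FL c u v : L u -> L v -> F (u + c *: v) = F u + c * F v.
  move=> Lu Lv; rewrite /F mulr_sumr -big_split; apply: eq_bigr => i _ /=.
  by rewrite actD actZ fL //; apply: LA.
have F0 : F 0 = 0 by rewrite /F big1 // => i _; rewrite act0.
have FZ c v : L v -> F (c *: v) = c * F v.
  by move=> Lv; rewrite -[_ *: _]add0r FL // F0 add0r.
have FN v : L v -> F (- v) = - F v by move=> Lv; rewrite -scaleN1r FZ // mulN1r.
have Fg v : F (act g v) = F v.
  rewrite /F; case: (p) p0 gp => // q _ gq.
  rewrite big_ord_recr big_ord_recl /= act1 addrC; congr (_ + _).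
    by rewrite -actM -expgSr gq act1.
  by apply: eq_bigr => i _; rewrite -actM -expgSr.
have FgV v : F (act g^-1%g v) = F v by rewrite -[LHS]Fg actVK.
(* Invariance under [g] and its inverse gives [F y = B x y * F x] and [F x = B x y * F y], while
   [B x y ^+ 2 < 1]. *)
have [Fx Fy] : F x = 0 /\ F y = 0.
  have e1 : F y = B x y * F x.
    have := Fg y; rewrite actM !act_rr // refl_self ?root_norm //.
    rewrite (_ : refl x (- y) = - y + (2 * B x y) *: x);
      last by rewrite /reflection !BE (BC y x); vec.
    by rewrite FL ?FN; [lra|exact: Lroot|exact/Lroot/root_opp|exact: Lroot].
  have e2 : F x = B x y * F y.
    have := FgV x; rewrite /g invgM !rrV // actM !act_rr // refl_self
      ?root_norm //.
    rewrite (_ : refl y (- x) = - x + (2 * B x y) *: y);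
      last by rewrite /reflection !BE; vec.
    by rewrite FL ?FN; [lra|exact: Lroot|exact/Lroot/root_opp|exact: Lroot].
  have /andP[dm d1] := dxy.
  have : F x = 0.
    have e3 : F x = B x y * (B x y * F x) by rewrite -e1.
    have /eqP : F x * (1 - B x y ^+ 2) = 0 by rewrite mulrBr mulr1 {1}e3; ring.
    by rewrite mulf_eq0 => /orP[/eqP //|/eqP]; nra.
  by move=> Fx; rewrite e1 Fx mulr0.
(* A root in [M w] makes some summand of [F] nonpositive, so it lies in one of the finitely many
   inversion sets of the [g ^+ i * w]. Passing from [w] to [w * r a] with [F (act w a) < 0] shrinks
   [M w], so the search for [w] ends. *)
pose M w := [set z | PhiP z /\ F (act w z) <= 0].
have fM w : finite_set (M w).
  apply: (sub_finite_set (B := \bigcup_(i in `I_p) Nset (g ^+ i * w)%g));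
    last first.
    by apply: bigcup_finite => [|i _]; [exact: finite_II|exact: Nset_finite].
  move=> z [pz Fz]; apply: contrapT => h; move: Fz; apply/negP; rewrite -ltNge.
  have h' i : (i < p)%N -> 0 < f (act (g ^+ i)%g (act w z)).
    move=> ip; rewrite -actM; apply: (fPLC _ _).2; apply: root_not_neg.
      by apply: root_act; case: pz.
    by move=> n; apply: h; exists i.
  rewrite /F (bigD1 (Ordinal p0)) //= ltr_pwDl ?h' //.
  by apply: sumr_ge0 => i _; rewrite ltW // h'.
have [w wP] : exists w, forall a, Delta a -> 0 <= F (act w a).
  suff [w] : exists w, forall a, Delta a -> 0 <= F (act w a) by exists w.
  have [n] := ubnP (card (M 1%g)); move: (1%g : W) => w.
  elim: n w => // n IH w /ltnSE wn.
  have [|/existsNP[a /not_implyP[Da /negP]]] := pselect (forall a, Delta a -> 0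
    <= F (act w a)).
    by exists w.
  rewrite -ltNge => Fa; apply: (IH (w * r a)%g); apply: leq_trans wn.
  have aK u : refl a (refl a u) = u by rewrite reflK // simple_norm.
  apply: (@leq_ltn_trans (card (M w `\ a))); last first.
    apply: (card_sub_lt (x := a) (fM w)) => [u []||[_ /(_ erefl)]] //.
    by split; [exact: simple_PhiP|exact: ltW].
  apply: (card_inj_le (f := refl a)) => //.
  - by apply: sub_finite_set (fM w) => u [].
  - move=> z [[rz pz]]; rewrite actM act_r // => Fz.
    have za : z <> a.
      move=> e; move: Fz; rewrite e refl_self ?simple_norm // actN FN;
        last first.
        exact/LA/LD.
      by lra.
    split; first by split=> //; split; [rewrite -act_r //;
      exact: root_act|exact: simple_perm].
    move=> /= e; apply: (pos_not_neg pz); rewrite -[z]aK e.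
    exact/neg_refl_self/simple_PhiP.
  - by move=> u v _ _ /(congr1 (refl a)); rewrite !aK.
pose I := [set a | Delta a /\ F (act w a) = 0].
(* The moved functional is nonnegative on [Delta], so where it vanishes on a positive combination,
   only simple roots in [I] carry positive coefficients. *)
have PI v : pos v -> L v /\ 0 <= F (act w v) /\ (F (act w v) = 0 -> PLC I v).
  elim/PLC_ind => [c a c0 Da|u u' [Lu [Fu Iu]] [Lu' [Fu' Iu']]].
    have La := LD a Da; split; first exact: LZ.
    rewrite actZ FZ; last exact: LA.
    split; first by rewrite mulr_ge0 ?wP // ltW.
    move=> /eqP; rewrite mulf_eq0 gt_eqF //= => /eqP Fa.
    by apply: PLC_scale => //; apply: PLC_mem.
  rewrite -[u']scale1r; split; first exact: LL.
  rewrite actD actZ FL ?mul1r; [|exact: LA|exact: LA].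
  split; first exact: addr_ge0.
  by move=> e; rewrite scale1r; apply: PLC_add; [apply: Iu|apply: Iu']; lra.
have rootI z : Phi z -> F z = 0 -> PLC I (act w^-1%g z) \/ PLC I (- act w^-1%g
  z).
  move=> rz Fz; have [pz|nz] := root_pos_neg (root_act w^-1%g rz); [left|right].
    by apply: (PI _ pz).2.2; rewrite actVK.
  apply: (PI _ nz).2.2; rewrite actN actVK FN ?Fz ?oppr0 //; exact: Lroot.
exists w^-1%g, I; split; [by move=> a []| |exact: rootI|exact: rootI].
apply: sub_finite_set (fM w) => z [pz]; split=> //.
suff [] : L z /\ F (act w z) = 0 by move=> _ ->.
elim/PLC_ind: b => [c a c0 [Da Fa]|u v [Lu Fu] [Lv Fv]].
  by split; [exact/LZ/LD|rewrite actZ FZ ?Fa ?mulr0 //; exact/LA/LD].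
rewrite -[v]scale1r; split; first exact: LL.
rewrite actD actZ FL ?Fu ?Fv ?mulr0 ?addr0 //; exact: LA.
Qed.

(** There are finitely many subsets [I] of [Delta], so the union [G] of the finite parabolic
    subsystems is finite, and up to signs every pair in question can be moved into [G]. *)
Lemma finite_root_values : finite_set Delta -> exists K : set R, finite_set K /\
  forall x y, Phi x -> Phi y -> -1 < B x y < 1 -> K (B x y).
Proof.
move=> fD.
pose G := \bigcup_(I in [set I | I `<=` Delta /\ finite_set (PhiP `&` PLC I)])
  (PhiP `&` PLC I).
have fG : finite_set G.
  apply: bigcup_finite => [|I []//].
  by apply: sub_finite_set (finite_powerset fD) => I [].
exists ((fun p => B p.1 p.2) @` (G `*` G) `|` (fun p => - B p.1 p.2) @` (G `*`
  G)).
split; first by rewrite finite_setU; split; apply: finite_image;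
  apply: finite_setX.
move=> x y rx ry dxy; have [w [I [ID fI hx hy]]] := finite_parabolic fD rx ry
  dxy.
have GI z : Phi z -> PLC I z -> G z.
  by move=> rz Iz; exists I => //; split=> //; split=> //; apply: PLC_sub Iz.
have rwx := root_act w rx; have rwy := root_act w ry.
rewrite -(act_form w); case: hx hy => hx [] hy.
- by left; exists (act w x, act w y) => //; split; apply: GI.
- right; exists (act w x, - act w y); first by split; apply: GI => //;
    apply: root_opp.
  by rewrite /= BNr opprK.
- right; exists (- act w x, act w y); first by split; apply: GI => //;
    apply: root_opp.
  by rewrite /= BNl opprK.
- left; exists (- act w x, - act w y); first by split; apply: GI => //;
    apply: root_opp.
  by rewrite /= BNl BNr opprK.
Qed.

Lemma canon_simple a : Delta a -> canon [set: W] a.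
Proof.
move=> Da; split; first by split=> //; apply: simple_PhiP.
by move=> z [[rz pz] _] za; apply: simple_perm.
Qed.

(** Since [B x x] is positive, so is [B x a] for some simple [a]; it is less than 1, as [x] and [a]
    are distinct elementary roots. Reflecting in [a] could only add [a] to the dominated roots,
    which [B (refl a x) a < 0] excludes. *)
Lemma elementary_step x : elementary x -> ~ Delta x -> exists a z,
  [/\ Delta a, elementary z, -1 < B z a < 0, x = refl a z
    & (len (rr z) < len (rr x))%N].
Proof.
move=> [px ex] nDx; have [rx posx] := px.
have [a Da xa0] : exists2 a, Delta a & 0 < B x a.
  apply: contrapT => h; have h' a : Delta a -> B x a <= 0.
    by move=> Da; rewrite leNgt; apply/negP => xa; apply: h; exists a.
  have : B x x <= 0; last by rewrite root_norm // ler10.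
  elim/PLC_ind: {2}x / posx => [c a c0 Da|u v hu hv].
    by rewrite BZr pmulr_rle0 // h'.
  by rewrite BDr; lra.
have xa : x <> a by move=> e; apply: nDx; rewrite e.
have ca := canon_simple Da; have Px : Psi [set: W] x by [].
have ra := simple_root Da; have pa := simple_PhiP Da.
have pz : PhiP (refl a x) by case: (canon_perm subgroupT ca Px xa).
have ax2 : B (refl a x) a = - B x a.
  by rewrite /reflection !BE simple_norm //; ring.
(* Otherwise [a] would be the sum of a positive multiple of [x] and a positive root, making [x]
   proportional to [a] by extremality. The negativity is what [len_conj] needs. *)
have nxa : neg (refl x a).
  apply: root_not_pos; first exact: root_refl.
  move=> p; have [||c c0 e] := @simple_extremal a ((2 * B a x) *: x) (refl x a)
    1 Da _ p.
  - by apply: PLC_scale; rewrite // (BC a x) mulr_gt0.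
  - by rewrite /reflection; vec.
  - apply: xa; apply: (root_parallel (c := (2 * B a x)^-1 * c)) => //.
    rewrite -scalerA -e scalerA mulVf ?scale1r //.
    by rewrite (BC a x) mulf_neq0 // ?lt0r_neq0 // pnatr_eq0.
exists a, (refl a x); split=> //.
- split=> //; apply/seteqP; split=> // u du.
  have [ua|ua] := pselect (u = a).
    have [_ _] := du; rewrite ua => /(dom_ge1 pz pa); rewrite ax2; clear xa;
      lra.
  have := dominatedIn_refl_sub subgroupT ca Px xa.
  by rewrite !dominatedInT ex image_set0; apply.
- rewrite ax2 oppr_lt0 xa0 andbT ltrN2 ltNge; apply/negP => xa1.
  apply: xa; apply: elementary_comparable => //; split=> //.
  by rewrite -dominatedInT; apply: dominatedIn_canon.
- by rewrite reflK // simple_norm.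
- exact: (len_conj subgroupT ca Px xa nxa).
Qed.

Section ElementaryChain.
Variables (y b : nat -> V) (k : nat).
Hypotheses (ye : forall i, (i <= k)%N -> elementary (y i))
  (bD : forall i, (i < k)%N -> Delta (b i))
  (yb : forall i, (i < k)%N -> -1 < B (y i.+1) (b i) < 0)
  (yE : forall i, (i < k)%N -> y i = refl (b i) (y i.+1)).

(* All values up to -1 are identified: by chain_le, once B (y j) a <= -1 this
   persists for smaller indices, and a no longer occurs among the b i. *)
Let state i a : R := Num.max (-1) (B (y i) a).

(** Passing to a smaller index adds a positive multiple of some [b j]. It differs from [a], since
    [B (y j.+1) (b j) > -1], and distinct simple roots pair nonpositively. *)
Lemma chain_le i n a : (i + n <= k)%N -> Delta a -> B (y (i + n)%N) a <= -1 ->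
  B (y i) a <= -1.
Proof.
elim: n => [|n IH] ik Da; first by rewrite addn0.
rewrite addnS in ik *; move=> h; apply: IH => //; first exact: ltnW.
have ba : a <> b (i + n)%N.
  by move=> e; have /andP[] := yb ik; rewrite -e; clear e; lra.
rewrite yE // /reflection !BE; have := simple_le0 (bD ik) Da (nesym ba).
by have /andP[_] := yb ik; clear ba; nra.
Qed.

Lemma chain_diff i n : (i + n <= k)%N -> exists c : nat -> R,
  (forall l, (l < n)%N -> 0 < c l) /\
  y i - y (i + n)%N = \sum_(l < n) c l *: b (i + l)%N.
Proof.
elim: n => [|n IH] ik; first by exists (fun=> 0); rewrite addn0 subrr big_ord0.
rewrite addnS in ik *; have [c [c0 cE]] := IH (ltnW ik).
exists (upd n c (- (2 * B (y (i + n).+1) (b (i + n)%N)))); split=> [l|].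
  rewrite /upd ltnS leq_eqVlt; case: eqP => //= [_ _|_ /c0 //].
  by have /andP[] := yb ik; lra.
rewrite big_ord_recr /= /upd eqxx.
rewrite (eq_bigr (fun l : 'I_n => c l *: b (i + l)%N)); last first.
  by move=> l _; rewrite ltn_eqF.
rewrite -cE (yE ik) /reflection; vec.
Qed.

(* If two states agree, y i - y (i + n) is orthogonal to every b involved, hence
   isotropic, so that B (y i) (y (i + n)) = 1 and one root dominates the other. *)
Lemma chain_states_distinct i n : (0 < n)%N -> (i + n <= k)%N ->
  exists2 a, Delta a & state i a <> state (i + n)%N a.
Proof.
move=> n0 ik; apply: contrapT => h.
have same a : Delta a -> state i a = state (i + n)%N a.
  by move=> Da; apply: contrapT => ne; apply: h; exists a.
have [c [c0 cE]] := chain_diff ik.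
have orth l : (l < n)%N -> B (y i - y (i + n)%N) (b (i + l)%N) = 0.
  move=> ln; have lk : (i + l < k)%N by apply: leq_trans ik; rewrite ltn_add2l.
  have Db := bD lk; have e : ((i + l).+1 + (n - l.+1) = i + n)%N by lia.
  (* Otherwise [chain_le] would carry the bound back to the index [(i + l).+1], against [yb]. So
     clipping hides nothing at this simple root, and equal states mean equal inner products. *)
  have gt : -1 < B (y (i + n)%N) (b (i + l)%N).
    rewrite ltNge; apply/negP => le1.
    have := @chain_le (i + l).+1 (n - l.+1) (b (i + l)%N).
    by rewrite e => /(_ ik Db le1); have /andP[] := yb lk; lra.
  have := same _ Db; rewrite /state (max_idPr (ltW gt)) => es.
  rewrite !BE -es; apply/eqP; rewrite subr_eq0; apply/eqP; move: es.
  by rewrite /Num.max; case: ltP => //; lra.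
have dd : B (y i - y (i + n)%N) (y i - y (i + n)%N) = 0.
  rewrite {2}cE; apply: (big_ind (fun v => B _ v = 0)) => [|u v hu hv|l _].
  - by rewrite B0r.
  - by rewrite BDr hu hv addr0.
  - by rewrite BZr orth ?mulr0.
have ei : elementary (y i) by apply: ye; lia.
have ej : elementary (y (i + n)%N) by apply: ye.
have yy : y i = y (i + n)%N.
  apply: elementary_comparable => //; move: dd;
    rewrite !BE (BC (y (i + n)%N) (y i)).
  by rewrite !root_norm; [lra|case: ej => -[]|case: ei => -[]].
(* With equal roots, [chain_diff] writes 0 as a positive combination of the [b]. *)
move: cE; rewrite yy subrr => /esym cE; apply: pos_neq0; rewrite -cE.
rewrite -(big_mkord xpredT (fun l => c l *: b (i + l)%N)); apply: PLC_sum.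
- by move=> l; rewrite mem_index_iota => /= ln; apply: bD;
    apply: leq_trans ik; rewrite ltn_add2l.
- by move=> l; rewrite mem_index_iota => /= ln; apply/ltW/c0.
- by exists 0%N; [rewrite mem_index_iota|apply: c0].
Qed.

End ElementaryChain.

Theorem elementary_finite : finite_set Delta -> finite_set elementary.
Proof.
move=> fD; have [K [fK KP]] := finite_root_values fD.
pose D : seq V := fset_set Delta.
have DP a : a \in D <-> Delta a by rewrite /D in_fset_set // inE.
pose st x := [seq Num.max (-1) (B x a) | a <- D].
(* The value [-1] stands for everything clipped; 1 occurs only at [x = a], because an elementary
   root pairing to at least 1 with a simple root equals it. *)
pose K' := K `|` [set -1; 1].
have fK' : finite_set K' by rewrite finite_setU; split=> //; exact: finite_set2.
pose Sts := [set s : seq R | size s = size D /\ forall u : R, u \in s -> K' u].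
have fSts : finite_set Sts by apply: finite_words.
have stP x : elementary x -> Sts (st x).
  move=> ex; split; first by rewrite size_map.
  have [[rx px] _] := ex.
  move=> _ /mapP[a /DP Da ->]; have [le1|gt] := leP (B x a) (-1).
    by right; left.
  have [lt1|ge1] := ltP (B x a) 1.
    by left; apply: KP; rewrite ?gt //; apply: simple_root.
  right; right; suff -> : x = a by rewrite simple_norm.
  apply: elementary_comparable => //; split; first exact: simple_PhiP.
  by rewrite -dominatedInT; apply: dominatedIn_canon; apply: canon_simple.
(* The roots reached from [Delta] by [n] simple reflections. A descending chain with [k] steps shows
   [k.+1] distinct states, whence [k < card Sts]. *)
pose F := fix F n : set V :=
  if n is n'.+1 then (fun p => refl p.1 p.2) @` (Delta `*` F n') else Delta.
have fF n : finite_set (F n).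
  by elim: n => //= n IH; apply: finite_image; apply: finite_setX.
apply: (sub_finite_set (B := \bigcup_(n in `I_(card Sts)) F n)); last first.
  by apply: bigcup_finite => //; apply: finite_II.
move=> x ex.
suff [k [y [b [y0 ye bD yb [yE yk]]]]] : exists k (y b : nat -> V),
  [/\ y 0%N = x, forall i, (i <= k)%N -> elementary (y i),
    forall i, (i < k)%N -> Delta (b i),
    forall i, (i < k)%N -> -1 < B (y i.+1) (b i) < 0 &
    (forall i, (i < k)%N -> y i = refl (b i) (y i.+1)) /\ Delta (y k)].
  exists k => /=.
    have <- : card `I_k.+1 = k.+1 by apply/card_fset_set; exact: card_eqxx.
    apply: (card_inj_le (f := fun i => st (y i)) fSts) => [i /= ik|i j /= ik jk
      e|].
    - by apply: stP; apply: ye.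
    - have ne i' n : (0 < n)%N -> (i' + n <= k)%N -> st (y i') <> st (y (i' +
        n)%N).
        move=> n0 ik' e'; have [a Da] := chain_states_distinct ye bD yb yE n0
          ik'.
        by apply; move/eq_in_map: e' => /(_ a); apply; apply/DP.
      case: (ltngtP i j) => // ij; exfalso.
        by apply: (ne i (j - i)%N); rewrite ?subn_gt0 // subnKC // ltnW.
      by apply: (ne j (i - j)%N); rewrite ?subn_gt0 // subnKC // ltnW.
    - exact: finite_II.
  have h n : (n <= k)%N -> F n (y (k - n)%N).
    elim: n => [|n IH] nk; first by rewrite subn0.
    exists (b (k - n.+1)%N, y (k - n)%N) => /=.
      by split; [apply: bD; lia|apply: IH; apply: ltnW].
    by rewrite [RHS]yE; [congr (refl _ (y _)); lia|lia].
  by rewrite -y0 -(subnn k); apply: h.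
have [n] := ubnP (len (rr x)); elim: n x ex => // n IH x ex /ltnSE xn.
have [Dx|nDx] := pselect (Delta x).
  by exists 0%N, (fun=> x), (fun=> x); split=> // i; rewrite leqn0.
have [a [z [Da ez za xE lz]]] := elementary_step ex nDx.
have [k [y [b [y0 ye bD yb [yE yk]]]]] := IH z ez (leq_trans lz xn).
exists k.+1, (fun i => if i is i'.+1 then y i' else x), (fun i => if i is i'.+1
  then b i' else a).
split=> //; [by case|by case|by case=> [|i] /= ik;
  [rewrite y0|apply: yb]|split=> //].
by case=> [|i] /= ik; [rewrite y0|apply: yE].
Qed.

End CoxeterTheory.

Theorem corollary3p23 (R : realType) (V : lmodType R) (B : {symmetric V})
    (Delta : set V) (W : groupType) (r : V -> W) (act : W -> V -> V)
    (basisD : root_basis B Delta) (coxW : coxeter_system B Delta r)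
    (actW : geometric_action B Delta r act) :
  (forall n : nat, (0 < n)%N ->
     refls_of_height B Delta r act n `<=`
       [set u : W | exists t t' : W,
          [/\ refls_of_height B Delta r act 0 t,
              exists2 m : nat, (m <= n - 1)%N &
                refls_of_height B Delta r act m t'
            & u = (t * t' * t)%g]]) /\
  (infinite_set [set: W] -> finite_set (simple_refls Delta r) ->
     finite_set (refls_of_height B Delta r act 0) /\
     forall n : nat, (0 < n)%N ->
       [/\ finite_set (refls_of_height B Delta r act n),
           (0 < #|` fset_set (refls_of_height B Delta r act n)|)%N
         & (#|` fset_set (refls_of_height B Delta r act n)|
              <= #|` fset_set (refls_of_height B Delta r act 0)| ^ n.+1
                 - #|` fset_set (refls_of_height B Delta r act 0)| ^ n)%N]).
Proof.
split; first exact: refls_of_height_conj basisD coxW actW.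
move=> iW fS; apply: (refls_of_height_card basisD coxW actW) => //.
apply: (elementary_finite basisD coxW actW).
exact: (simple_finite basisD coxW actW fS).
Qed.
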